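(* Let $H$ be a $d$-regular $r$-uniform hypergraph on $n$ vertices, $r\geq 3$. There is a constant $c=c(r)>0$ depending only on $r$ such that: (i) If $d\leq n^{2/3}$, then $\lambda_2^{(r)}(H)\geq c\sqrt{d}$; in general, for any $p\geq 1$, $\lambda_2^{(p)}(H)\geq c\,n^{1-r/p}\sqrt{d}$. (ii) If $d<\frac{n^2}{4}$, then $\mu^{(r)}(H)\geq c\sqrt{d}$; in general, for any $p\geq 1$, $\mu^{(p)}(H)\geq c\,n^{1-r/p}\sqrt{d}$. (iii) If $r\geq 4$ and $\frac{n^2}{4}\leq d\leq \frac{1}{2}\binom{n-1}{r-1}$, then $\mu^{(r)}(H)\geq \frac{cd}{n}$; in general, for any $p\geq 1$, $\mu^{(p)}(H)\geq c\,d\,n^{-r/p}$.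
   Context: For an $r$-uniform hypergraph $H$ on vertex set $V$ with $|V|=n$, its adjacency map is the symmetric multilinear function $\tau_H$ on $(\mathbb{C}^V)^r$ given by $$\tau_H(x_1,\dots,x_r)=\frac{1}{(r-1)!}\sum_{\substack{v_1,\dots,v_r\in V\\ \{v_1,\dots,v_r\}\in E(H)}}x_1(v_1)\cdots x_r(v_r).$$ The normalized adjacency map is $\sigma_H=\tau_H-\frac{r|E(H)|}{n^r}J$, where $J(x_1,\dots,x_r)=\sum_{v_1,\dots,v_r\in V}x_1(v_1)\cdots x_r(v_r)$. For $p>0$, $\|x\|_p=(\sum_v|x(v)|^p)^{1/p}$. Define $$\lambda_2^{(p)}(H)=\sup_{x\in\mathbb{R}^V,\ \|x\|_p=1}\sigma_H(x,\dots,x),\qquad \mu^{(p)}(H)=\sup_{\|x_1\|_p=\dots=\|x_r\|_p=1}|\sigma_H(x_1,\dots,x_r)|.$$ $H$ is $d$-regular if every vertex lies in exactly $d$ edges. *)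

(* Defs.v *)
From HB Require Import structures.
From mathcomp Require Import all_boot all_order all_algebra.
From mathcomp Require Import all_classical all_reals all_analysis.
From mathcomp Require Import complex.
Set Implicit Arguments. Unset Strict Implicit. Unset Printing Implicit Defensive.
Import Order.TTheory GRing.Theory Num.Theory.
Local Open Scope ring_scope.
Local Open Scope classical_set_scope.

Definition uniform (V : finType) (r : nat) (E : {set {set V}}) : Prop :=
  forall e, e \in E -> #|e| = r.

Definition regular (V : finType) (d : nat) (E : {set {set V}}) : Prop :=
  forall v : V, #|[set e in E | v \in e]| = d.

Definition tauH (K : fieldType) (V : finType) (r : nat) (E : {set {set V}})
    (x : 'I_r -> V -> K) : K :=
  ((r.-1)`!)%:R^-1 *
    \sum_(v : {ffun 'I_r -> V} | [set v i | i : 'I_r] \in E)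
       \prod_(i < r) x i (v i).

Definition Jmap (K : fieldType) (V : finType) (r : nat)
    (x : 'I_r -> V -> K) : K :=
  \sum_(v : {ffun 'I_r -> V}) \prod_(i < r) x i (v i).

Definition sigmaH (K : fieldType) (V : finType) (r : nat) (E : {set {set V}})
    (x : 'I_r -> V -> K) : K :=
  tauH E x - ((r * #|E|)%:R / (#|V| ^ r)%:R) * Jmap x.

Definition lpnormR (R : realType) (V : finType) (p : R) (x : V -> R) : R :=
  (\sum_(v : V) `|x v| `^ p) `^ (p^-1).

Definition lpnormC (R : realType) (V : finType) (p : R) (x : V -> R[i]) : R :=
  (\sum_(v : V) (ComplexField.Normc.normc (x v)) `^ p) `^ (p^-1).

Definition lambda2 (R : realType) (V : finType) (r : nat) (E : {set {set V}})
    (p : R) : R :=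
  sup [set sigmaH E (fun _ : 'I_r => x) | x in [set x : V -> R | lpnormR p x = 1]].

Definition mu (R : realType) (V : finType) (r : nat) (E : {set {set V}})
    (p : R) : R :=
  sup [set ComplexField.Normc.normc (sigmaH E x)
        | x in [set x : 'I_r -> V -> R[i] | forall i, lpnormC p (x i) = 1]].

(* Main.v *)
Require Import Defs.
From mathcomp Require Import all_classical all_reals all_analysis complex ring lra.
From mathcomp Require Import all_boot all_order all_algebra.
Set Implicit Arguments. Unset Strict Implicit. Unset Printing Implicit Defensive.
Import Order.TTheory GRing.Theory Num.Theory.
Local Open Scope ring_scope.

(** In each case it suffices to find bounded vectors at which [sigmaH] is large: dividing by
    the l^p norms, which are at most [b n^(1/p)] for vectors with entries in [[-b, b]], gives
    the bound for every [p]. Most of these vectors are found by averaging over random signs.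

    For (ii), all variables but one are random signs, and the last one is the sign of the
    resulting linear form. Its coefficient at a vertex is a decoupled Rademacher chaos with
    second moment [d (1/(r-1)! - q)], where [q = d / n^(r-1)], and fourth moment at most
    [3^(r-1)] times the square of that, so its mean absolute value is of order [sqrt d].

    For (iii), average [sigmaH (x, x, 1, ..., 1)] over random signs [x]: only the tuples with
    [v_1 = v_2] survive, these are never edges, and the mean is [- q n^(r-1) = - d].

    For (i) a positive value is needed. Take [x_v = 1 + y_v], where [y_v] is the truncation to
    [[-1, 1]] of [eps_v / 4 + (eta / sqrt d) * (the sum of eps_w over the neighbours w of v)].
    The [1 + y_v] are nonnegative increasing functions of the signs, with mean 1, so by
    Harris's inequality the mean of their product over an edge is at least the mean of [(1 +
    y_u) (1 + y_v)] for two of its vertices. Both factors increase with [eps_u], which makes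
    this mean at least [1 + eta / (16 sqrt d)], and the edges gain [eta n sqrt d / 16]. The
    Efron-Stein inequality bounds the second moment of the sum of the [y_v] by [n (1/4 + (r-1)
    eta sqrt d)^2], so the term [q J] costs at most order [d + eta^2 d^2], which is smaller
    when [d <= n^(2/3)], [eta] is small and [n] is large. For bounded [n], a vector supported
    on one edge with entry sum zero and positive product suffices. *)

Section FiniteMean.
Variables (R : realFieldType) (T : finType).
Implicit Types F G : T -> R.

Definition mean F : R := (\sum_t F t) / #|T|%:R.

Lemma eq_mean F G : F =1 G -> mean F = mean G.
Proof. by move=> FG; rewrite /mean; under eq_bigr do rewrite FG. Qed.

Lemma ler_mean F G : (forall t, F t <= G t) -> mean F <= mean G.
Proof. by move=> FG; rewrite ler_wpM2r ?invr_ge0 //; apply: ler_sum. Qed.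

Lemma mean_ge0 F : (forall t, 0 <= F t) -> 0 <= mean F.
Proof. by move=> F0; rewrite divr_ge0 // sumr_ge0. Qed.

Lemma meanD F G : mean (fun t => F t + G t) = mean F + mean G.
Proof. by rewrite /mean big_split mulrDl. Qed.

Lemma meanB F G : mean (fun t => F t - G t) = mean F - mean G.
Proof. by rewrite /mean sumrB mulrBl. Qed.

Lemma meanZ c F : mean (fun t => c * F t) = c * mean F.
Proof. by rewrite /mean -mulr_sumr mulrA. Qed.

Lemma mean_sum (I : Type) (s : seq I) (P : pred I) (F : I -> T -> R) :
  mean (fun t => \sum_(i <- s | P i) F i t) = \sum_(i <- s | P i) mean (F i).
Proof. by rewrite /mean exchange_big mulr_suml. Qed.

Lemma mean_involution (h : T -> T) F : involutive h -> mean (fun t => F (h t)) = mean F.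
Proof. by move=> hK; rewrite /mean [in RHS](reindex_inj (inv_inj hK)). Qed.

Lemma mean_antisymmetric (h : T -> T) F :
  involutive h -> (forall t, F (h t) = - F t) -> mean F = 0.
Proof.
move=> hK Fh; have := mean_involution F hK; rewrite /mean (eq_bigr _ (fun t _ => Fh t)) sumrN.
by rewrite mulNr; lra.
Qed.

Lemma mean_cauchy_schwarz F G :
  mean (fun t => F t * G t) ^+ 2 <= mean (fun t => F t ^+ 2) * mean (fun t => G t ^+ 2).
Proof.
set FF := mean (fun t => F t ^+ 2); set GG := mean (fun t => G t ^+ 2).
set FG := mean (fun t => F t * G t).
have lagrange u : mean (fun t => (F u * G t - G u * F t) ^+ 2) =
    GG * F u ^+ 2 - (2 * FG) * (F u * G u) + FF * G u ^+ 2.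
  rewrite (eq_mean (G := fun t => F u ^+ 2 * G t ^+ 2 - (2 * (F u * G u)) * (F t * G t) +
    G u ^+ 2 * F t ^+ 2)) => [|t]; last by ring.
  by rewrite meanD meanB !meanZ -/FF -/GG -/FG; ring.
have : 0 <= mean (fun u => mean (fun t => (F u * G t - G u * F t) ^+ 2)).
  by apply: mean_ge0 => u; apply: mean_ge0 => t; apply: sqr_ge0.
by under eq_mean do rewrite lagrange; rewrite meanD meanB !meanZ -/FF -/GG -/FG; lra.
Qed.

Lemma mean_mul_le k A B F G : 0 <= k -> 0 <= A -> 0 <= B ->
  mean (fun t => F t ^+ 2) <= k * A ^+ 2 -> mean (fun t => G t ^+ 2) <= k * B ^+ 2 ->
  mean (fun t => F t * G t) <= k * (A * B).
Proof.
move=> k_ge0 A_ge0 B_ge0 F_le G_le.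
apply: le_trans (ler_norm _) _; rewrite -[leRHS]ger0_norm ?mulr_ge0 // -ler_sqr ?nnegrE //.
rewrite !real_normK ?num_real //; apply: le_trans (mean_cauchy_schwarz F G) _.
rewrite (_ : (k * (A * B)) ^+ 2 = (k * A ^+ 2) * (k * B ^+ 2)); last by ring.
by apply: ler_pM => //; apply: mean_ge0 => t; apply: sqr_ge0.
Qed.

(* Littlewood's comparison of the L^1, L^2 and L^4 norms, by averaging the inequality
   [3 u ^ 2 <= 2 u + u ^ 4] at [u = |F t| / (k s)]. *)
Lemma mean_norm_ge k s F : 0 < k -> 0 < s ->
  mean (fun t => F t ^+ 2) = s ^+ 2 -> mean (fun t => F t ^+ 4) <= k ^+ 2 * s ^+ 4 ->
  s <= k * mean (fun t => `|F t|).
Proof.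
move=> k_gt0 s_gt0 mean_sqr mean_pow4_le.
pose c := k * s; have c_gt0 : 0 < c by rewrite mulr_gt0.
have pointwise t : 3 * c ^+ 2 * F t ^+ 2 <= 2 * c ^+ 3 * `|F t| + F t ^+ 4.
  rewrite (exprM (F t) 2 2) -(real_normK (num_real (F t))).
  have := normr_ge0 (F t); set a := `|F t| => a_ge0.
  rewrite -subr_ge0 (_ : _ - _ = a * (a - c) ^+ 2 * (a + 2 * c)); last by ring.
  apply: mulr_ge0; first by apply: mulr_ge0 => //; apply: sqr_ge0.
  by apply: addr_ge0 => //; apply: mulr_ge0 => //; apply: ltW.
have := ler_mean pointwise; rewrite meanD !meanZ mean_sqr => mean_le.
have scale_gt0 : 0 < 2 * c ^+ 2 * s by rewrite !mulr_gt0 ?exprn_gt0.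
by rewrite -(ler_pM2l scale_gt0); rewrite /c in mean_le *; lra.
Qed.

Hypothesis T_gt0 : (0 < #|T|)%N.

Lemma mean_cst c : mean (fun=> c) = c.
Proof. by rewrite /mean sumr_const -[c *+ _]mulr_natr mulfK // pnatr_eq0 -lt0n. Qed.

Lemma exists_ge_mean F : exists t, mean F <= F t.
Proof.
case/card_gt0P: T_gt0 => t0 _; exists [arg max_(t > t0) F t]%O.
by rewrite -[leRHS]mean_cst; apply: ler_mean => t; case: arg_maxP => // u _; apply.
Qed.

End FiniteMean.

Local Notation cube I := {ffun I -> bool}.

Section SignCube.
Variables (R : realFieldType) (I : finType).
Implicit Types (i j : I) (x : cube I) (F G : cube I -> R) (s : seq I).

Definition rademacher i x : R := (-1) ^+ x i.

Definition flip i x : cube I := [ffun j => (j == i) (+) x j].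

Lemma card_cube_gt0 : (0 < #|cube I|)%N.
Proof. by rewrite card_ffun card_bool expn_gt0. Qed.

Lemma rademacher_sqr i x : rademacher i x ^+ 2 = 1.
Proof. exact: sqrr_sign. Qed.

Lemma normr_rademacher i x : `|rademacher i x| = 1.
Proof. exact: normr_sign. Qed.

Lemma rademacher_flip i j x : rademacher j (flip i x) = (-1) ^+ (j == i) * rademacher j x.
Proof. by rewrite /rademacher ffunE signr_addb. Qed.

Lemma flipK i : involutive (flip i).
Proof. by move=> x; apply/ffunP => j; rewrite !ffunE addbA addbb. Qed.

Lemma flipC i j x : flip i (flip j x) = flip j (flip i x).
Proof. by apply/ffunP => k; rewrite !ffunE addbCA. Qed.

Lemma mean_rademacherM i F : (forall x, F (flip i x) = F x) ->
  mean (fun x => rademacher i x * F x) = 0.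
Proof.
move=> Fi; apply: (mean_antisymmetric (flipK i)) => x.
by rewrite Fi rademacher_flip eqxx mulN1r mulNr.
Qed.

Lemma mean_rademacher2 i j : mean (fun x => rademacher i x * rademacher j x) = (i == j)%:R.
Proof.
have [<-|ij] := eqVneq.
  by under eq_mean do rewrite -expr2 rademacher_sqr; rewrite mean_cst ?card_cube_gt0.
by apply: mean_rademacherM => x; rewrite rademacher_flip eq_sym (negPf ij) mul1r.
Qed.

Lemma mean_odd F : (forall x, F [ffun i => ~~ x i] = - F x) -> mean F = 0.
Proof. by apply: mean_antisymmetric => x; apply/ffunP => i; rewrite !ffunE negbK. Qed.

Definition flip_avg i F x : R := (F x + F (flip i x)) / 2.
(* The factor [rademacher i x] orients the difference from sign -1 to sign 1, although the
   [i]-th sign is -1 when [x i] is [true]. *)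
Definition flip_diff i F x : R := rademacher i x * (F x - F (flip i x)) / 2.

Lemma eq_flip_diff i F G : F =1 G -> flip_diff i F =1 flip_diff i G.
Proof. by move=> FG x; rewrite /flip_diff !FG. Qed.

Lemma flip_avg_flip i F x : flip_avg i F (flip i x) = flip_avg i F x.
Proof. by rewrite /flip_avg flipK addrC. Qed.

Lemma flip_diff_flip i F x : flip_diff i F (flip i x) = flip_diff i F x.
Proof. by rewrite /flip_diff flipK rademacher_flip eqxx mulN1r mulNr -mulrN opprB. Qed.

Lemma mean_flip_avg i F : mean (flip_avg i F) = mean F.
Proof.
rewrite (eq_mean (G := fun x => 2^-1 * (F x + F (flip i x)))) => [|x]; last exact: mulrC.
by rewrite meanZ meanD (mean_involution _ (flipK i)); field.
Qed.

Lemma flip_avgM i F G x : flip_avg i (fun y => F y * G y) x =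
  flip_avg i F x * flip_avg i G x + flip_diff i F x * flip_diff i G x.
Proof.
rewrite (_ : flip_diff i F x * flip_diff i G x =
  rademacher i x ^+ 2 * ((F x - F (flip i x)) * (G x - G (flip i x)) / 4)).
  by rewrite rademacher_sqr /flip_avg; field.
by rewrite /flip_diff; field.
Qed.

Lemma flip_diffM i F G x : flip_diff i (fun y => F y * G y) x =
  flip_avg i F x * flip_diff i G x + flip_diff i F x * flip_avg i G x.
Proof. by rewrite /flip_diff /flip_avg; field. Qed.

Lemma flip_diff_sum i (T : Type) (r : seq T) (F : T -> cube I -> R) x :
  flip_diff i (fun y => \sum_(t <- r) F t y) x = \sum_(t <- r) flip_diff i (F t) x.
Proof. by rewrite /flip_diff -sumrB mulr_sumr mulr_suml. Qed.

Lemma flip_diff_avg i j F x :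
  flip_diff j (flip_avg i F) x = if j == i then 0 else flip_avg i (flip_diff j F) x.
Proof.
case: eqVneq => [->|ji]; first by rewrite /flip_diff flip_avg_flip subrr mulr0 mul0r.
by rewrite /flip_diff /flip_avg rademacher_flip (negPf ji) mul1r (flipC j i); field.
Qed.

Lemma mean_mul_flip i F G : mean (fun x => F x * G x) =
  mean (fun x => flip_avg i F x * flip_avg i G x) +
  mean (fun x => flip_diff i F x * flip_diff i G x).
Proof. by rewrite -meanD -(mean_flip_avg i); apply: eq_mean => x; apply: flip_avgM. Qed.

Lemma mean_sqr_flip i F : mean (fun x => F x ^+ 2) =
  mean (fun x => flip_avg i F x ^+ 2) + mean (fun x => flip_diff i F x ^+ 2).
Proof. exact: mean_mul_flip. Qed.

Definition flip_avgs s F : cube I -> R := foldr flip_avg F s.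

Lemma mean_flip_avgs s F : mean (flip_avgs s F) = mean F.
Proof. by elim: s => //= i s IH; rewrite mean_flip_avg. Qed.

Lemma flip_avgs_flip s i F x : i \in s -> flip_avgs s F (flip i x) = flip_avgs s F x.
Proof.
elim: s x => //= j s IH x; rewrite inE => /predU1P[->|/IH invariant]; first exact: flip_avg_flip.
by rewrite /flip_avg flipC !invariant.
Qed.

Lemma flip_invariant_eq_mean F : (forall i x, F (flip i x) = F x) -> forall x, F x = mean F.
Proof.
move=> Fflip x; suff constant y : F y = F x.
  by rewrite (eq_mean constant) mean_cst ?card_cube_gt0.
pose patch s : cube I := [ffun i => if i \in s then y i else x i].
have Fpatch s : F (patch s) = F x.
  elim: s => [|i s <-]; first by congr F; apply/ffunP => i; rewrite ffunE.
  have [y_i|y_i] := eqVneq (y i) (patch s i); last rewrite -(Fflip i (patch s)).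
    congr F; apply/ffunP => j; move: y_i; rewrite !ffunE inE.
    by have [->|_] := eqVneq j i.
  congr F; apply/ffunP => j; move: y_i; rewrite !ffunE inE.
  have [->|_] //= := eqVneq j i.
  by case: (y i); case: (if _ then _ else _).
by rewrite -(Fpatch (enum I)); congr F; apply/ffunP => i; rewrite ffunE mem_enum.
Qed.

Lemma flip_avgs_enum F x : flip_avgs (enum I) F x = mean F.
Proof.
rewrite -(mean_flip_avgs (enum I)); apply: flip_invariant_eq_mean => i y.
by apply: flip_avgs_flip; rewrite mem_enum.
Qed.

Lemma mean_sqr_flip_diff_avgs s i F :
  mean (fun x => flip_diff i (flip_avgs s F) x ^+ 2) <= mean (fun x => flip_diff i F x ^+ 2).
Proof.
elim: s => //= j s; apply: le_trans.
rewrite (mean_sqr_flip j (flip_diff i (flip_avgs s F))) -[leLHS]addr0.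
apply: lerD; last by apply: mean_ge0 => x; apply: sqr_ge0.
apply: ler_mean => x; rewrite flip_diff_avg; case: eqP => // _.
by rewrite expr0n sqr_ge0.
Qed.

Theorem efron_stein F :
  mean (fun x => F x ^+ 2) <= mean F ^+ 2 + \sum_i mean (fun x => flip_diff i F x ^+ 2).
Proof.
suff {F} le_avgs s F : mean (fun x => F x ^+ 2) <=
    mean (fun x => flip_avgs s F x ^+ 2) + \sum_(i <- s) mean (fun x => flip_diff i F x ^+ 2).
  apply: le_trans (le_avgs (enum I) F) _; rewrite big_enum lerD2r.
  by under eq_mean do rewrite flip_avgs_enum; rewrite mean_cst ?card_cube_gt0.
elim: s => [|i s] /=; first by rewrite big_nil addr0.
rewrite big_cons (mean_sqr_flip i (flip_avgs s F)).
by have := mean_sqr_flip_diff_avgs s i F; lra.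
Qed.

Definition sign_increasing F := forall i x, 0 <= flip_diff i F x.

Lemma flip_avg_ge0 i F x : (forall y, 0 <= F y) -> 0 <= flip_avg i F x.
Proof. by move=> F_ge0; rewrite divr_ge0 ?addr_ge0. Qed.

Lemma sign_increasing_flip_avgs s F : sign_increasing F -> sign_increasing (flip_avgs s F).
Proof.
move=> F_incr; elim: s => //= j s IH i x; rewrite flip_diff_avg; case: ifP => // _.
by apply: flip_avg_ge0; apply: IH.
Qed.

Lemma mean_flip_avgsM_le s F G : sign_increasing F -> sign_increasing G ->
  mean (fun x => flip_avgs s F x * flip_avgs s G x) <= mean (fun x => F x * G x).
Proof.
move=> F_incr G_incr; elim: s => //= i s; apply: le_trans.
rewrite (mean_mul_flip i (flip_avgs s F)) lerDl; apply: mean_ge0 => x.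
by rewrite mulr_ge0 ?sign_increasing_flip_avgs.
Qed.

Lemma mean_flip_diff_avgs s i F : i \notin s ->
  mean (flip_diff i (flip_avgs s F)) = mean (flip_diff i F).
Proof.
elim: s => //= j s IH; rewrite inE => /norP[ij /IH <-]; rewrite -[RHS](mean_flip_avg j).
by apply: eq_mean => x; rewrite flip_diff_avg (negPf ij).
Qed.

(* Averaging out every coordinate but [i] decreases [mean (F * G)] and leaves functions of
   the single sign [i], for which equality holds. *)
Theorem harris_coordinate i F G : sign_increasing F -> sign_increasing G ->
  mean F * mean G + mean (flip_diff i F) * mean (flip_diff i G) <= mean (fun x => F x * G x).
Proof.
move=> F_incr G_incr; pose s := [seq j <- enum I | j != i].
have avg_cst H x : flip_avg i (flip_avgs s H) x = mean H.
  rewrite -(mean_flip_avgs (i :: s) H); apply: flip_invariant_eq_mean => j y.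
  by apply: (@flip_avgs_flip (i :: s)); rewrite inE mem_filter mem_enum andbT orbN.
have diff_cst H x : flip_diff i (flip_avgs s H) x = mean (flip_diff i H).
  rewrite -(@mean_flip_diff_avgs s) ?mem_filter ?eqxx //.
  apply: flip_invariant_eq_mean => j y; case: (eqVneq j i) => [->|ji].
    exact: flip_diff_flip.
  have avgs_flip z : flip_avgs s H (flip j z) = flip_avgs s H z.
    by apply: flip_avgs_flip; rewrite mem_filter ji mem_enum.
  by rewrite /flip_diff (flipC i j) !avgs_flip rademacher_flip eq_sym (negPf ji) mul1r.
apply: le_trans (mean_flip_avgsM_le s F_incr G_incr); rewrite [leRHS](mean_mul_flip i).
under [X in _ <= X + _]eq_mean do rewrite !avg_cst.
under [X in _ <= _ + X]eq_mean do rewrite !diff_cst.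
by rewrite !mean_cst ?card_cube_gt0.
Qed.

Lemma sign_increasingM F G : (forall x, 0 <= F x) -> (forall x, 0 <= G x) ->
  sign_increasing F -> sign_increasing G -> sign_increasing (fun x => F x * G x).
Proof.
by move=> F_ge0 G_ge0 F_incr G_incr i x; rewrite flip_diffM addr_ge0 // mulr_ge0 // flip_avg_ge0.
Qed.

Lemma sign_increasing_prod (T : Type) (r : seq T) (F : T -> cube I -> R) :
  (forall t x, 0 <= F t x) -> (forall t, sign_increasing (F t)) ->
  sign_increasing (fun x => \prod_(t <- r) F t x).
Proof.
move=> F_ge0 F_incr; elim: r => [|t r IH] i x.
  by rewrite /flip_diff !big_nil subrr mulr0 mul0r.
rewrite (@eq_flip_diff _ _ (fun x => F t x * \prod_(u <- r) F u x)) => [|y]; last exact: big_cons.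
by apply: sign_increasingM => // y; apply: prodr_ge0.
Qed.

Corollary harris F G : sign_increasing F -> sign_increasing G ->
  mean F * mean G <= mean (fun x => F x * G x).
Proof.
move=> F_incr G_incr; apply: le_trans (mean_flip_avgsM_le (enum I) F_incr G_incr).
by under [leRHS]eq_mean do rewrite !flip_avgs_enum; rewrite mean_cst ?card_cube_gt0.
Qed.

Corollary harris_prod (T : Type) (r : seq T) (F : T -> cube I -> R) :
  (forall t x, 0 <= F t x) -> (forall t, sign_increasing (F t)) ->
  \prod_(t <- r) mean (F t) <= mean (fun x => \prod_(t <- r) F t x).
Proof.
move=> F_ge0 F_incr; elim: r => [|t r IH].
  by rewrite big_nil; under eq_mean do rewrite big_nil; rewrite mean_cst ?card_cube_gt0.
rewrite big_cons; apply: le_trans (ler_wpM2l (mean_ge0 (F_ge0 t)) IH) _.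
by under [leRHS]eq_mean do rewrite big_cons; apply: harris => //; apply: sign_increasing_prod.
Qed.

Section RademacherSums.
Variable a : I -> R.

Let rademacher_sum_flip s i x : i \notin s ->
  \sum_(j <- s) a j * rademacher j (flip i x) = \sum_(j <- s) a j * rademacher j x.
Proof.
move=> i_s; apply: eq_big_seq => j js; rewrite rademacher_flip.
by rewrite (negPf (memPn i_s j js)) mul1r.
Qed.

Lemma mean_sqr_rademacher_sum s : uniq s ->
  mean (fun x => (\sum_(j <- s) a j * rademacher j x) ^+ 2) = \sum_(j <- s) a j ^+ 2.
Proof.
elim: s => [_|i s IH /= /andP[i_s s_uniq]].
  by under eq_mean do rewrite big_nil expr0n; rewrite mean_cst ?card_cube_gt0 ?big_nil.
pose X x := \sum_(j <- s) a j * rademacher j x.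
rewrite big_cons -(IH s_uniq) (eq_mean (G := fun x =>
  a i ^+ 2 + rademacher i x * (2 * a i * X x) + X x ^+ 2)) => [|x].
  rewrite !meanD mean_rademacherM => [|x]; last by rewrite /X rademacher_sum_flip.
  by rewrite addr0 mean_cst ?card_cube_gt0.
rewrite big_cons -/(X x); move: (X x) => y.
by rewrite /rademacher; case: (x i); rewrite ?expr0 ?expr1; ring.
Qed.

Lemma mean_pow4_rademacher_sum s : uniq s ->
  mean (fun x => (\sum_(j <- s) a j * rademacher j x) ^+ 4) <= 3 * (\sum_(j <- s) a j ^+ 2) ^+ 2.
Proof.
elim: s => [_|i s IH /= /andP[i_s s_uniq]].
  under eq_mean do rewrite big_nil expr0n.
  by rewrite mean_cst ?card_cube_gt0 // mulr_ge0 ?sqr_ge0.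
have := IH s_uniq; have := mean_sqr_rademacher_sum s_uniq.
set A := \sum_(j <- s) a j ^+ 2; pose X x := \sum_(j <- s) a j * rademacher j x => X_sqr X_pow4_le.
rewrite big_cons -/A (eq_mean (G := fun x => a i ^+ 4 + 6 * a i ^+ 2 * X x ^+ 2 + X x ^+ 4 +
  rademacher i x * (4 * a i ^+ 3 * X x + 4 * a i * X x ^+ 3))) => [|x].
  rewrite !meanD meanZ mean_rademacherM => [|x]; last by rewrite /X rademacher_sum_flip.
  rewrite X_sqr addr0 mean_cst ?card_cube_gt0 //.
  by have := sqr_ge0 (a i ^+ 2); rewrite -exprM /=; move: X_pow4_le; rewrite -/X; lra.
rewrite big_cons -/(X x); move: (X x) => y.
by rewrite /rademacher; case: (x i); rewrite ?expr0 ?expr1; ring.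
Qed.

End RademacherSums.

End SignCube.

Section Clip.
Variable R : realFieldType.
Implicit Types t h : R.

Definition clip t : R := Num.max (-1) (Num.min 1 t).

Variant clip_spec t : R -> Type :=
  | ClipLow of t < -1 : clip_spec t (-1)
  | ClipId of -1 <= t <= 1 : clip_spec t t
  | ClipHigh of 1 < t : clip_spec t 1.

Lemma clipP t : clip_spec t (clip t).
Proof.
rewrite /clip; case: (ltP 1 t) => t1; last first.
  by case: (leP (-1) t) => tN1; constructor; rewrite ?tN1.
by rewrite max_r; [constructor | lra].
Qed.

Lemma clip_itv t : -1 <= clip t <= 1.
Proof. by case: clipP; lra. Qed.

Lemma clipN t : clip (- t) = - clip t.
Proof. by do 2 case: clipP => ?; lra. Qed.

Lemma clip_increment_itv t h : 0 <= h -> 0 <= (clip (t + h) - clip (t - h)) / 2 <= h.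
Proof. by do 2 case: clipP => ?; lra. Qed.

Lemma clip_increment_ge t h : 0 <= h <= 2^-1 ->
  h * (1 - 4 * t ^+ 2) <= (clip (t + h) - clip (t - h)) / 2.
Proof.
move=> /andP[h_ge0 h_le]; have [/andP[t_ge t_le]|t_large] := boolP (- 2^-1 <= t <= 2^-1).
  apply: le_trans (_ : h <= _); first by have := sqr_ge0 t; nra.
  by do 2 case: clipP => ?; lra.
have /andP[+ _] := clip_increment_itv t h_ge0; apply: le_trans.
rewrite mulr_ge0_le0 // subr_le0 -[leLHS](expr1n _ 2) (_ : 4 * t ^+ 2 = `|2 * t| ^+ 2).
  rewrite lerXn2r ?nnegrE // normrM ger0_norm //.
  by move: t_large; rewrite -ler_norml -ltNge; lra.
by rewrite real_normK ?num_real //; ring.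
Qed.

Variables (I : finType) (a : I -> R).
Implicit Types (i : I) (x : cube I).

Definition clip_sum x : R := clip (\sum_j a j * rademacher R j x).

Let flip_diff_clip_sum i x (rest := \sum_(j | j != i) a j * rademacher R j x) :
  flip_diff i clip_sum x = (clip (rest + a i) - clip (rest - a i)) / 2.
Proof.
have sum_i y : \sum_j a j * rademacher R j y =
    \sum_(j | j != i) a j * rademacher R j y + a i * rademacher R i y.
  by rewrite (bigD1 i) //= addrC.
have rest_flip : \sum_(j | j != i) a j * rademacher R j (flip i x) = rest.
  by apply: eq_bigr => j /negPf ji; rewrite rademacher_flip ji mul1r.
rewrite /flip_diff /clip_sum !sum_i rest_flip -/rest rademacher_flip eqxx.
by rewrite /rademacher; case: (x i); rewrite !(mulr1, mul1r, mulN1r, mulrN, opprK, opprB).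
Qed.

Lemma mean_clip_sum : mean clip_sum = 0.
Proof.
apply: mean_odd => x; rewrite /clip_sum -clipN -sumrN; congr clip.
by apply: eq_bigr => j _; rewrite /rademacher ffunE signrN mulrN.
Qed.

Hypothesis a_ge0 : forall i, 0 <= a i.

Lemma flip_diff_clip_sum_itv i x : 0 <= flip_diff i clip_sum x <= a i.
Proof. by rewrite flip_diff_clip_sum clip_increment_itv. Qed.

Lemma mean_flip_diff_clip_sum_ge i : a i <= 2^-1 ->
  a i * (1 - 4 * \sum_(j | j != i) a j ^+ 2) <= mean (flip_diff i clip_sum).
Proof.
move=> a_le; pose rest x := \sum_(j | j != i) a j * rademacher R j x.
have rest_sqr : mean (fun x => rest x ^+ 2) = \sum_(j | j != i) a j ^+ 2.
  rewrite -big_filter -mean_sqr_rademacher_sum ?filter_uniq ?index_enum_uniq //.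
  by apply: eq_mean => x; rewrite big_filter.
rewrite (_ : 1 - _ = mean (fun x => 1 - 4 * rest x ^+ 2)); last first.
  by rewrite meanB meanZ rest_sqr mean_cst ?card_cube_gt0.
by rewrite -meanZ; apply: ler_mean => x; rewrite flip_diff_clip_sum clip_increment_ge ?a_ge0.
Qed.

End Clip.

Section FinfunCons.
Variables (A : Type) (m : nat).

Definition ord_cons (a : A) (x : 'I_m -> A) (i : 'I_m.+1) : A := oapp x a (unlift ord0 i).

Lemma ord_cons0 a x : ord_cons a x ord0 = a.
Proof. by rewrite /ord_cons unlift_none. Qed.

Lemma ord_consS a x i : ord_cons a x (lift ord0 i) = x i.
Proof. by rewrite /ord_cons liftK. Qed.

Definition fcons (a : A) (g : {ffun 'I_m -> A}) : {ffun 'I_m.+1 -> A} := finfun (ord_cons a g).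

End FinfunCons.

Lemma sum_fcons (A : finType) m (M : nmodType) (F : {ffun 'I_m.+1 -> A} -> M) :
  \sum_f F f = \sum_a \sum_g F (fcons a g).
Proof.
rewrite pair_big /= (reindex (fun p : A * {ffun 'I_m -> A} => fcons p.1 p.2)) //=.
exists (fun f => (f ord0, [ffun j => f (lift ord0 j)])) => [[a g] _|f _] /=.
  by congr (_, _); [|apply/ffunP => j]; rewrite !ffunE ?ord_cons0 ?ord_consS.
apply/ffunP => i; rewrite ffunE; case: (unliftP ord0 i) => [j|] ->.
  by rewrite ord_consS ffunE.
by rewrite ord_cons0.
Qed.

Lemma sum_ffun_ord0 (A : finType) (M : nmodType) (F : {ffun 'I_0 -> A} -> M) :
  \sum_f F f = F (ffun0 (card_ord 0)).
Proof.
rewrite (bigD1 (ffun0 (card_ord 0))) //= big1 ?addr0 // => f /eqP[].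
by apply/ffunP => -[].
Qed.

Lemma imset_fcons (A : finType) m (a : A) (g : {ffun 'I_m -> A}) :
  [set fcons a g i | i : 'I_m.+1] = a |: [set g i | i : 'I_m].
Proof.
apply/setP => b; rewrite in_setU1; apply/imsetP/idP => [[i _ ->]|].
  rewrite ffunE; case: (unliftP ord0 i) => [j|] ->; last by rewrite ord_cons0 eqxx.
  by rewrite ord_consS imset_f ?orbT.
case/predU1P => [->|/imsetP[j _ ->]]; first by exists ord0; rewrite // ffunE ord_cons0.
by exists (lift ord0 j); rewrite // ffunE ord_consS.
Qed.

Section Multiform.
Variables (K : comNzRingType) (V : finType).

Definition multiform m (a : {ffun 'I_m -> V} -> K) (x : 'I_m -> V -> K) : K :=
  \sum_g a g * \prod_(i < m) x i (g i).

Lemma eq_multiform m (a : {ffun 'I_m -> V} -> K) x y : x =2 y -> multiform a x = multiform a y.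
Proof. by move=> xy; apply: eq_bigr => g _; congr (_ * _); apply: eq_bigr => i _. Qed.

Lemma multiform_cons m (a : {ffun 'I_m.+1 -> V} -> K) y x :
  multiform a (ord_cons y x) = \sum_v y v * multiform (fun g => a (fcons v g)) x.
Proof.
rewrite /multiform sum_fcons; apply: eq_bigr => v _; rewrite mulr_sumr.
apply: eq_bigr => g _; rewrite big_ord_recl ffunE !ord_cons0 mulrCA; congr (_ * (_ * _)).
by apply: eq_bigr => i _; rewrite ffunE !ord_consS.
Qed.

Lemma multiform_contract m (a : {ffun 'I_m.+1 -> V} -> K) y x :
  multiform a (ord_cons y x) = multiform (fun g => \sum_v a (fcons v g) * y v) x.
Proof.
rewrite multiform_cons /multiform; under eq_bigr do rewrite mulr_sumr.
rewrite exchange_big /=; apply: eq_bigr => g _; rewrite mulr_suml.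
by apply: eq_bigr => v _; rewrite mulrCA mulrA.
Qed.

Lemma multiformZ m (a : {ffun 'I_m -> V} -> K) (c : 'I_m -> K) x :
  multiform a (fun i v => c i * x i v) = \prod_i c i * multiform a x.
Proof.
by rewrite /multiform mulr_sumr; apply: eq_bigr => g _; rewrite big_split /= mulrCA.
Qed.

Lemma multiform_eq0 m (a : {ffun 'I_m -> V} -> K) x i :
  (forall v, x i v = 0) -> multiform a x = 0.
Proof.
by move=> xi; apply: big1 => g _; rewrite (bigD1 i) //= xi mul0r mulr0.
Qed.

End Multiform.

Section RademacherChaos.
Variables (R : realFieldType) (V : finType).

Definition signs m (t : {ffun 'I_m -> cube V}) (i : 'I_m) (v : V) : R := rademacher R v (t i).

Lemma signs_fcons m t (g : {ffun 'I_m -> cube V}) :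
  signs (fcons t g) =2 ord_cons (fun v => rademacher R v t) (signs g).
Proof.
move=> i v; rewrite /signs ffunE; case: (unliftP ord0 i) => [j|] ->; first by rewrite !ord_consS.
by rewrite !ord_cons0.
Qed.

Lemma card_cubes_gt0 m : (0 < #|{ffun 'I_m -> cube V}|)%N.
Proof. by rewrite card_ffun expn_gt0 card_cube_gt0. Qed.

Lemma mean_fcons (A : finType) m (F : {ffun 'I_m.+1 -> A} -> R) :
  mean F = mean (fun a => mean (fun g => F (fcons a g))).
Proof. by rewrite /mean sum_fcons -mulr_suml !card_ffun !card_ord expnSr natrM invfM mulrA. Qed.

Lemma mean_sqr_sum_sqr_rademacher_le (G : finType) (b : G -> V -> R) :
  mean (fun t => (\sum_g (\sum_v b g v * rademacher R v t) ^+ 2) ^+ 2) <=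
  3 * (\sum_g \sum_v b g v ^+ 2) ^+ 2.
Proof.
under eq_mean do rewrite expr2 big_distrlr.
rewrite expr2 big_distrlr /= mulr_sumr mean_sum; apply: ler_sum => g _.
rewrite mulr_sumr mean_sum; apply: ler_sum => h _.
apply: mean_mul_le => //; try by apply: sumr_ge0 => v _; apply: sqr_ge0.
all: by under eq_mean do rewrite -exprM; apply: mean_pow4_rademacher_sum; apply: index_enum_uniq.
Qed.

Lemma mean_sqr_multiform m (a : {ffun 'I_m -> V} -> R) :
  mean (fun t => multiform a (signs t) ^+ 2) = \sum_g a g ^+ 2.
Proof.
elim: m a => [|m IH] a.
  rewrite sum_ffun_ord0 -[RHS](mean_cst (card_cubes_gt0 0)); apply: eq_mean => t.
  by rewrite /multiform sum_ffun_ord0 big_ord0 mulr1.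
rewrite mean_fcons sum_fcons exchange_big /=.
under eq_mean => t do under eq_mean do
  rewrite (eq_multiform _ (signs_fcons _ _)) multiform_contract.
under eq_mean do rewrite IH; rewrite mean_sum; apply: eq_bigr => g _.
by rewrite mean_sqr_rademacher_sum // index_enum_uniq.
Qed.

Lemma mean_pow4_multiform_le m (a : {ffun 'I_m -> V} -> R) :
  mean (fun t => multiform a (signs t) ^+ 4) <= 3 ^+ m * (\sum_g a g ^+ 2) ^+ 2.
Proof.
elim: m a => [|m IH] a.
  rewrite sum_ffun_ord0 mul1r -[leRHS](mean_cst (card_cubes_gt0 0)); apply: ler_mean => t.
  by rewrite /multiform sum_ffun_ord0 big_ord0 mulr1 -exprM.
rewrite mean_fcons sum_fcons exchange_big /=.
under eq_mean => t do under eq_mean do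
  rewrite (eq_multiform _ (signs_fcons _ _)) multiform_contract.
apply: le_trans (ler_mean (fun t => IH _)) _; rewrite meanZ exprSr -mulrA ler_wpM2l ?exprn_ge0 //.
exact: mean_sqr_sum_sqr_rademacher_le.
Qed.

End RademacherChaos.

Lemma decoupled_khintchine (R : rcfType) (V : finType) m (a : {ffun 'I_m -> V} -> R) :
  0 < \sum_g a g ^+ 2 ->
  Num.sqrt (\sum_g a g ^+ 2) <= 2 ^+ m * mean (fun t => `|multiform a (signs R t)|).
Proof.
move=> a_sqr_gt0; apply: mean_norm_ge; rewrite ?exprn_gt0 ?sqrtr_gt0 //.
  by rewrite mean_sqr_multiform sqr_sqrtr // ltW.
apply: le_trans (mean_pow4_multiform_le a) _.
rewrite [_ ^+ 4](exprM _ 2 2) sqr_sqrtr ?(ltW a_sqr_gt0) // ler_wpM2r ?sqr_ge0 //.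
by rewrite -exprM mulnC exprM lerXn2r ?nnegrE //; lra.
Qed.

Lemma imset_card_injective (A : finType) m (g : {ffun 'I_m -> A}) :
  #|[set g i | i : 'I_m]| = m -> injective g.
Proof.
move=> card_g i j; have /imset_injP g_inj : #|g @: 'I_m| == #|'I_m| by rewrite card_g card_ord.
exact: g_inj.
Qed.

Lemma card_ffun_imset (A : finType) m (e : {set A}) : #|e| = m ->
  #|[set g : {ffun 'I_m -> A} | [set g i | i : 'I_m] == e]| = m`!.
Proof.
move=> card_e.
rewrite -(ffactnn m) -[X in X ^_ _]card_e -[X in _ ^_ X](card_ord m) -card_inj_ffuns_on.
apply: eq_card => g; rewrite !inE; apply/eqP/andP => [ge|[/ffun_onP ge /injectiveP g_inj]].
  split; first by apply/ffun_onP => i; rewrite -ge imset_f.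
  by apply/injectiveP; apply: imset_card_injective; rewrite ge.
apply/eqP; rewrite eqEcard card_imset // card_ord card_e leqnn andbT.
by apply/subsetP => _ /imsetP[i _ ->].
Qed.

Section RegularHypergraph.
Variables (V : finType) (m : nat) (E : {set {set V}}) (d : nat).
Hypothesis E_uniform : uniform m.+1 E.
Implicit Types (v : V) (e : {set V}) (g : {ffun 'I_m -> V}).

Lemma link_notin v g : v |: [set g i | i : 'I_m] \in E -> v \notin [set g i | i : 'I_m].
Proof.
move=> /E_uniform; rewrite cardsU1; case: (v \in _) => //=; rewrite add0n => card_im.
by have := leq_imset_card g 'I_m; rewrite card_im card_ord ltnn.
Qed.

Hypothesis E_regular : regular d E.

Lemma handshake : (m.+1 * #|E| = #|V| * d)%N.
Proof.
transitivity (\sum_(e in E) \sum_v (v \in e : nat))%N.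
  rewrite mulnC -sum_nat_const; apply: eq_bigr => e /E_uniform <-.
  by rewrite -sum1_card big_mkcond; apply: eq_bigr => v _; case: (v \in e).
rewrite exchange_big -sum_nat_const; apply: eq_bigr => v _.
rewrite -(E_regular v) -sum1_card -big_mkcondr.
by apply: eq_bigl => e; rewrite inE.
Qed.

Lemma card_link v : #|[set g : {ffun 'I_m -> V} | v |: [set g i | i : 'I_m] \in E]| = (m`! * d)%N.
Proof.
rewrite -sum1_card (partition_big (fun g : {ffun 'I_m -> V} => v |: [set g i | i : 'I_m])
   (mem [set e in E | v \in e])) /=; last first.
  by move=> g; rewrite !inE eqxx /= => ->.
rewrite mulnC -(E_regular v) -sum_nat_const; apply: eq_bigr => e; rewrite inE => /andP[eE ve].
have ev : #|e :\ v| = m by have := cardsD1 v e; rewrite ve E_uniform //= => -[].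
rewrite -(card_ffun_imset ev) -sum1_card; apply: eq_bigl => g; rewrite !inE.
apply/andP/eqP => [[gE /eqP <-]|->]; last by rewrite setD1K // eE eqxx.
by rewrite setU1K // link_notin.
Qed.

Lemma card_link_le v : (m`! * d <= #|V|.-1 ^ m)%N.
Proof.
rewrite -(card_link v).
have -> : (#|V|.-1 ^ m)%N = #|ffun_on (mem [set~ v]) : pred {ffun 'I_m -> V}|.
  by rewrite card_ffun_on card_ord cardsC1.
apply/subset_leq_card/subsetP => g; rewrite inE => /link_notin vg.
by apply/ffun_onP => i; rewrite !inE; apply: contraNneq vg => <-; rewrite imset_f.
Qed.

End RegularHypergraph.

Section NormalizedAdjacency.
Variables (K : fieldType) (V : finType) (m : nat) (E : {set {set V}}).

Definition edge_density : K := (m.+1 * #|E|)%:R / (#|V| ^ m.+1)%:R.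

Definition sigma_coef (f : {ffun 'I_m.+1 -> V}) : K :=
  ([set f i | i : 'I_m.+1] \in E)%:R / (m`!)%:R - edge_density.

Lemma sigmaHE (x : 'I_m.+1 -> V -> K) : sigmaH E x = multiform sigma_coef x.
Proof.
rewrite /sigmaH /tauH /Jmap big_mkcond !mulr_sumr -sumrB; apply: eq_bigr => f _.
by rewrite /sigma_coef mulrBl; congr (_ - _); case: ifP; rewrite ?mul1r ?mul0r ?mulr0.
Qed.

Hypothesis E_uniform : uniform m.+1 E.

Lemma sigma_coef_repeat (g : {ffun 'I_m -> V}) i : sigma_coef (fcons (g i) g) = - edge_density.
Proof.
rewrite /sigma_coef imset_fcons; case: (boolP (_ \in E)) => [/(link_notin E_uniform)|_].
  by rewrite imset_f.
by rewrite mul0r sub0r.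
Qed.

Lemma sigmaH_diag (x : V -> K) : (m`!)%:R != 0 :> K ->
  sigmaH E (fun _ : 'I_m.+1 => x) =
  m.+1%:R * \sum_(e in E) \prod_(v in e) x v - edge_density * (\sum_v x v) ^+ m.+1.
Proof.
move=> m_fact; rewrite /sigmaH; congr (_ - _ * _); last first.
  by rewrite /Jmap -(bigA_distr_bigA (fun (_ : 'I_m.+1) v => x v)) prodr_const card_ord.
rewrite /tauH (partition_big (fun f : {ffun 'I_m.+1 -> V} => [set f i | i : 'I_m.+1]) (mem E)) //=.
rewrite !mulr_sumr; apply: eq_bigr => e eE.
transitivity ((m`!)%:R^-1 * \sum_(f in [set f : {ffun 'I_m.+1 -> V} |
    [set f i | i : 'I_m.+1] == e]) \prod_(v in e) x v).
  congr (_ * _); apply: eq_big => [f|f /andP[_ /eqP fe]].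
    by rewrite inE; case: eqP => [->|]; rewrite ?andbF // andbT.
  rewrite -fe big_imset //= => i j _ _.
  by apply: imset_card_injective; rewrite fe E_uniform.
rewrite sumr_const card_ffun_imset ?E_uniform // factS mulnC mulrnA.
by rewrite !mulrnAr mulr_natl -mulrnAl -(mulr_natr _^-1) mulVf ?mul1r.
Qed.

Variable d : nat.
Hypotheses (E_regular : regular d E) (V_neq0 : (#|V|%:R : K) != 0).

Lemma edge_density_regular : edge_density = d%:R / #|V|%:R ^+ m.
Proof.
by rewrite /edge_density (handshake E_uniform E_regular) natrM natrX exprS -mulf_div divff ?mul1r.
Qed.

End NormalizedAdjacency.

Section SignVectors.
Variables (R : rcfType) (V : finType) (m : nat) (E : {set {set V}}) (d : nat).
Hypotheses (E_uniform : uniform m.+1 E) (E_regular : regular d E) (V_gt0 : (0 < #|V|)%N).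
Local Notation n := (#|V|%:R : R).
Local Notation q := (edge_density R m E).
Local Notation fact_m := ((m`!)%:R : R).

Let n_ge1 : 1 <= n. Proof. by rewrite ler1n. Qed.
Let n_neq0 : n != 0. Proof. by rewrite pnatr_eq0 -lt0n. Qed.
Let fact_gt0 : 0 < fact_m. Proof. by rewrite ltr0n fact_gt0. Qed.
Let qE : q = d%:R / n ^+ m. Proof. exact: edge_density_regular. Qed.

Lemma sum_sqr_sigma_coef v :
  \sum_(g : {ffun 'I_m -> V}) sigma_coef R E (fcons v g) ^+ 2 = d%:R * (fact_m^-1 - q).
Proof.
pose edge (g : {ffun 'I_m -> V}) : R := (v |: [set g i | i : 'I_m] \in E)%:R.
have sum_edge : \sum_g edge g = fact_m * d%:R.
  rewrite -natrM -(card_link E_uniform E_regular v) -sum1_card natr_sum [RHS]big_mkcond.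
  by apply: eq_bigr => g _; rewrite /edge inE; case: (_ \in E).
rewrite (eq_bigr (fun g => edge g * (fact_m ^- 2 - 2 * q / fact_m) + q ^+ 2)) => [|g _]; last first.
  rewrite /sigma_coef imset_fcons /edge.
  by case: (_ \in E) => /=; field; rewrite gt_eqF.
rewrite big_split /= -mulr_suml sum_edge sumr_const card_ffun card_ord -(mulr_natr (q ^+ 2)) natrX.
by rewrite qE; field; rewrite expf_neq0 //= gt_eqF.
Qed.

Lemma fact_edge_density_le : (0 < m)%N -> fact_m * q <= 1 - n^-1.
Proof.
move=> m_gt0; have [v _] := card_gt0P V_gt0.
have n_pred : #|V|.-1%:R = n * (1 - n^-1).
  by rewrite -subn1 natrB // mulrBr mulr1 divff.
have := card_link_le E_uniform E_regular v.
rewrite -(ler_nat R) natrM natrX n_pred exprMn => le_link.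
rewrite qE mulrA ler_pdivrMr ?exprn_gt0 ?(lt_le_trans ltr01) //.
apply: le_trans le_link _; rewrite mulrC ler_wpM2r ?exprn_ge0 ?(le_trans ler01) //.
have n_inv : 0 <= 1 - n^-1 <= 1.
  by rewrite subr_ge0 invf_le1 ?(lt_le_trans ltr01) // n_ge1 gerBl invr_ge0 (le_trans ler01).
by rewrite -[leRHS]expr1; case/andP: n_inv => ? ?; rewrite ler_wiXn2l.
Qed.

Lemma edge_density_gap : (1 < m)%N -> d%:R < n ^+ 2 / 4 -> fact_m ^- 2 <= fact_m^-1 - q.
Proof.
move=> m_gt1 d_lt; have fact_ge2 : 2 <= fact_m.
  by rewrite ler_nat; apply: leq_trans (fact_geq m).
suff : fact_m * q <= 1 - fact_m^-1.
  move=> le_q; rewrite (_ : fact_m^-1 - q = fact_m^-1 * (1 - fact_m * q)).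
    by rewrite expr2 invfM ler_wpM2l ?invr_ge0 ?(ltW fact_gt0) //; lra.
  by field; rewrite gt_eqF.
have [n_le|n_gt] := lerP n fact_m.
  apply: le_trans (fact_edge_density_le (ltnW m_gt1)) _.
  by rewrite lerD2l lerN2 lef_pV2 ?posrE // (lt_le_trans ltr01).
apply: le_trans (_ : 2^-1 <= _); last by have : fact_m^-1 <= 2^-1; [rewrite lef_pV2 ?posrE | lra].
rewrite qE mulrA ler_pdivrMr ?exprn_gt0 ?(lt_le_trans ltr01) //.
have [m_le2|m_gt2] := leqP m 2.
  have m2 : m = 2%N by apply/eqP; rewrite eqn_leq m_le2.
  by have -> : fact_m = 2; [rewrite m2 | rewrite m2; lra].
rewrite (_ : n ^+ m = n ^+ (m - 3) * n ^+ 3); last by rewrite -exprD subnK.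
have : 1 <= n ^+ (m - 3) by apply: exprn_ege1.
have : 0 <= n ^+ 3 by rewrite exprn_ge0 // (le_trans ler01).
have : fact_m * d%:R <= n * (n ^+ 2 / 4) by apply: ler_pM => //; apply: ltW.
nra.
Qed.

Lemma exists_sigmaH_ge_sqrt : (1 < m)%N -> (0 < d)%N -> d%:R < n ^+ 2 / 4 ->
  exists2 x : 'I_m.+1 -> V -> R, (forall i v, `|x i v| <= 1) &
    (fact_m * 2 ^+ m)^-1 * (n * Num.sqrt d%:R) <= `|sigmaH E x|.
Proof.
move=> m_gt1 d_gt0 d_lt; have gap := edge_density_gap m_gt1 d_lt.
have N_gt0 : 0 < d%:R * (fact_m^-1 - q).
  by rewrite mulr_gt0 ?ltr0n //; apply: lt_le_trans gap; rewrite invr_gt0 exprn_gt0.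
pose L (t : {ffun 'I_m -> cube V}) v :=
  multiform (fun g => sigma_coef R E (fcons v g)) (signs R t).
have [t mean_le] := exists_ge_mean (card_cubes_gt0 V m) (fun t => \sum_v `|L t v|).
exists (ord_cons (fun v => Num.sg (L t v)) (signs R t)) => [i v|].
  case: (unliftP ord0 i) => [j|] ->; first by rewrite ord_consS normr_rademacher.
  by rewrite ord_cons0 normr_sg; case: (L t v == 0).
rewrite sigmaHE multiform_cons; under eq_bigr do rewrite -normrEsg.
apply: le_trans (ler_norm _); apply: le_trans mean_le; rewrite mean_sum.
rewrite mulrCA (mulr_natl _ #|V|) -sumr_const; apply: ler_sum => v _.
have := @decoupled_khintchine R V m (fun g => sigma_coef R E (fcons v g)).
rewrite sum_sqr_sigma_coef => /(_ N_gt0); rewrite -/(L _ v) => khintchine.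
rewrite mulrC invfM mulrA ler_pdivrMr ?exprn_gt0 // [leRHS]mulrC.
apply: le_trans khintchine; rewrite sqrtrM // ler_wpM2l ?sqrtr_ge0 //.
apply: le_trans (_ : Num.sqrt (fact_m ^- 2) <= _); last exact: ler_wsqrtr.
by rewrite -exprVn sqrtr_sqr ger0_norm // invr_ge0 ltW.
Qed.

End SignVectors.

Section EqualSigns.
Variables (R : realFieldType) (V : finType) (m : nat) (E : {set {set V}}) (d : nat).
Hypotheses (E_uniform : uniform m.+2 E) (E_regular : regular d E) (V_gt0 : (0 < #|V|)%N).

Let equal_signs (t : cube V) : 'I_m.+2 -> V -> R :=
  ord_cons (fun v => rademacher R v t) (ord_cons (fun v => rademacher R v t) (fun _ _ => 1)).

Lemma mean_sigmaH_equal_signs : mean (fun t => sigmaH E (equal_signs t)) = - d%:R.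
Proof.
pose c u v : R :=
  multiform (fun g => sigma_coef R E (fcons u (fcons v g))) (fun (_ : 'I_m) _ => 1).
have n_neq0 : #|V|%:R != 0 :> R by rewrite pnatr_eq0 -lt0n.
have c_diag u : c u u = - (d%:R / #|V|%:R).
  rewrite /c /multiform (eq_bigr (fun=> - edge_density R m.+1 E)) => [|g _].
    rewrite sumr_const card_ffun card_ord -[_ *+ _]mulr_natr natrX mulNr; congr (- _).
    rewrite (edge_density_regular E_uniform E_regular n_neq0) exprS; field.
    by rewrite n_neq0 expf_neq0.
  have g_head : fcons u g ord0 = u by rewrite ffunE ord_cons0.
  by rewrite big1 ?mulr1 // -[X in fcons X]g_head (sigma_coef_repeat _ E_uniform).
rewrite (eq_mean (G := fun t =>
  \sum_u \sum_v c u v * (rademacher R u t * rademacher R v t))) => [|t].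
  rewrite mean_sum (eq_bigr (fun=> - (d%:R / #|V|%:R))) => [|u _].
    by rewrite sumr_const -[_ *+ _]mulr_natr mulNr divfK.
  rewrite mean_sum (bigD1 u) //= big1 => [|v vu].
    by rewrite meanZ mean_rademacher2 eqxx mulr1 addr0 c_diag.
  by rewrite meanZ mean_rademacher2 eq_sym (negPf vu) mulr0.
rewrite sigmaHE multiform_cons; apply: eq_bigr => u _; rewrite multiform_cons mulr_sumr.
by apply: eq_bigr => v _; rewrite -/(c u v); ring.
Qed.

Lemma exists_sigmaH_ge_degree :
  exists2 x : 'I_m.+2 -> V -> R, (forall i v, `|x i v| <= 1) & d%:R <= `|sigmaH E x|.
Proof.
have [t mean_le] := exists_ge_mean (card_cube_gt0 V) (fun t => -1 * sigmaH E (equal_signs t)).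
exists (equal_signs t) => [i v|].
  rewrite /equal_signs; case: (unliftP ord0 i) => [j|] ->; rewrite ?ord_cons0 ?ord_consS.
    by case: (unliftP ord0 j) => [k|] ->; rewrite ?ord_cons0 ?ord_consS ?normr1 ?normr_rademacher.
  by rewrite normr_rademacher.
rewrite meanZ mean_sigmaH_equal_signs !mulN1r opprK in mean_le.
by apply: le_trans mean_le _; rewrite -normrN ler_norm.
Qed.

End EqualSigns.

Lemma expr1D_le_quadratic (R : realFieldType) (t : R) k : `|t| <= 1 ->
  (1 + t) ^+ k <= 1 + k%:R * t + 2 ^+ k * t ^+ 2.
Proof.
rewrite ler_norml => /andP[t_ge t_le].
suff sharp : (1 + t) ^+ k <= 1 + k%:R * t + (2 ^+ k - 1 - k%:R) * t ^+ 2.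
  apply: le_trans sharp _; rewrite lerD2l ler_wpM2r ?sqr_ge0 //.
  by have : 0 <= k%:R :> R; [exact: ler0n | lra].
elim: k => [|k IH]; first by rewrite !expr0; lra.
have coef_ge0 : 0 <= 2 ^+ k - 1 - k%:R :> R.
  by have := ltn_expl k (isT : (1 < 2)%N); rewrite -(ler_nat R) natrX -natr1; lra.
have t1_ge0 : 0 <= 1 + t by lra.
rewrite exprS; apply: le_trans (ler_wpM2l t1_ge0 IH) _.
have : (2 ^+ k - 1 - k%:R) * (t ^+ 2 * (1 - t)) >= 0.
  by rewrite mulr_ge0 // mulr_ge0 ?sqr_ge0 // subr_ge0.
by rewrite [2 ^+ _.+1]exprS -(natr1 k); lra.
Qed.

Lemma sigmaH_diag1D_ge (R : realFieldType) (V : finType) m (E : {set {set V}}) d (y : V -> R)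
    (n : R := #|V|%:R) (avg : R := n^-1 * \sum_v y v) :
  uniform m.+1 E -> regular d E -> (0 < #|V|)%N -> (forall v, `|y v| <= 1) ->
  m.+1%:R * (\sum_(e in E) \prod_(v in e) (1 + y v)) -
    n * d%:R * (1 + m.+1%:R * avg + 2 ^+ m.+1 * avg ^+ 2) <=
  sigmaH E (fun (_ : 'I_m.+1) v => 1 + y v).
Proof.
move=> E_uniform E_regular V_gt0 y_le1; have n_gt0 : 0 < n by rewrite ltr0n.
have avg_le1 : `|avg| <= 1.
  rewrite normrM normfV (gtr0_norm n_gt0) mulrC ler_pdivrMr // mul1r.
  apply: le_trans (ler_norm_sum _ _ _) _; rewrite /n -sum1_card natr_sum.
  exact: ler_sum.
have density : edge_density R m E * n ^+ m.+1 = n * d%:R.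
  rewrite (edge_density_regular E_uniform E_regular) ?gt_eqF // exprS mulrCA.
  by rewrite divfK // expf_neq0 ?gt_eqF.
rewrite (sigmaH_diag E_uniform) ?pnatr_eq0 -?lt0n ?fact_gt0 // lerD2l lerN2.
rewrite (_ : \sum_v _ = n * (1 + avg)); last first.
  by rewrite big_split sumr_const mulrDr mulr1 mulVKf // gt_eqF.
by rewrite exprMn mulrA density ler_wpM2l ?mulr_ge0 ?ler0n // expr1D_le_quadratic.
Qed.

Section SmoothedSigns.
Variables (R : realFieldType) (V : finType) (m : nat) (E : {set {set V}}) (d : nat).
Hypotheses (E_uniform : uniform m.+1 E) (E_regular : regular d E).

Definition adjacent (u w : V) : bool :=
  (u != w) && [exists e in E, (u \in e) && (w \in e)].

Lemma adjacentC u w : adjacent u w = adjacent w u.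
Proof.
rewrite /adjacent eq_sym; congr (_ && _); apply: eq_existsb => e.
by rewrite [X in _ && X]andbC.
Qed.

Lemma card_neighbours_le u : (#|[set w | adjacent u w]| <= m * d)%N.
Proof.
apply: leq_trans (_ : #|\bigcup_(e in [set e in E | u \in e]) (e :\ u)| <= _)%N.
  apply/subset_leq_card/subsetP => w; rewrite inE => /andP[uw /existsP[e /and3P[eE ue we]]].
  by apply/bigcupP; exists e; rewrite !inE ?eE // eq_sym uw.
apply: leq_trans (_ : \sum_(e in [set e in E | u \in e]) #|e :\ u| <= _)%N.
  elim/big_rec2: _ => [|e k s _ card_s]; first by rewrite cards0.
  by apply: leq_trans (leq_card_setU _ _) _; rewrite leq_add2l.
rewrite (eq_bigr (fun=> m)) => [|e]; last first.
  by rewrite inE => /andP[eE ue]; have := cardsD1 u e; rewrite ue E_uniform // => -[].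
by rewrite sum_nat_const E_regular mulnC.
Qed.

Variable b : R.
Hypotheses (b_itv : 0 <= b <= 2^-1) (b_sqr : (m * d)%:R * b ^+ 2 <= 16^-1).

(* The value [4^-1] and [b_sqr] keep the squares of the weights of a vertex summing to at most
   [8^-1], so that truncation preserves half of every weight on average. *)
Definition weight (u w : V) : R :=
  if w == u then 4^-1 else if adjacent u w then b else 0.

Lemma weight_itv u w : 0 <= weight u w <= 2^-1.
Proof. by rewrite /weight; case: ifP; [lra | case: ifP => // *; lra]. Qed.

Lemma weightC u w : weight u w = weight w u.
Proof. by rewrite /weight eq_sym adjacentC. Qed.

Lemma sum_weight_le (F : R -> R) u : F 0 = 0 -> 0 <= F b ->
  \sum_w F (weight u w) <= F 4^-1 + (m * d)%:R * F b.
Proof.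
move=> F0 Fb; rewrite (bigD1 u) //= /weight eqxx lerD2l.
rewrite (bigID (adjacent u)) /= [X in _ + X]big1 ?addr0; last first.
  by move=> w /andP[/negPf -> /negPf ->].
rewrite (eq_bigr (fun=> F b)) => [|w /andP[/negPf -> ->] //].
rewrite sumr_const -[leLHS]mulr_natl ler_wpM2r // ler_nat.
apply: leq_trans (card_neighbours_le u); apply/subset_leq_card/subsetP => w.
by rewrite !inE => /andP[].
Qed.

Definition smoothed_sign (v : V) (x : cube V) : R := clip_sum (weight v) x.

Let weight_ge0 u w : 0 <= weight u w. Proof. by have /andP[] := weight_itv u w. Qed.

Lemma mean_smoothed_sign v : mean (smoothed_sign v) = 0.
Proof. exact: mean_clip_sum. Qed.

Lemma smoothed_sign_itv v x : -1 <= smoothed_sign v x <= 1.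
Proof. exact: clip_itv. Qed.

Lemma mean_flip_diff_smoothed_sign_ge v w :
  weight v w / 2 <= mean (flip_diff w (smoothed_sign v)).
Proof.
have /andP[_ weight_le] := weight_itv v w.
apply: le_trans (mean_flip_diff_clip_sum_ge (weight_ge0 v) weight_le).
rewrite ler_wpM2l //.
have : \sum_(j | j != w) weight v j ^+ 2 <= \sum_j weight v j ^+ 2.
  by rewrite [leRHS](bigD1 w) //= lerDr sqr_ge0.
have := @sum_weight_le (fun t => t ^+ 2) v; rewrite expr0n sqr_ge0 => /(_ erefl isT).
by move: b_sqr; lra.
Qed.

Let bump (v : V) (x : cube V) : R := 1 + smoothed_sign v x.

Let bump_ge0 v x : 0 <= bump v x.
Proof. by have /andP[+ _] := smoothed_sign_itv v x; rewrite /bump; lra. Qed.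

Let flip_diff_bump v w x : flip_diff w (bump v) x = flip_diff w (smoothed_sign v) x.
Proof. by rewrite /flip_diff /bump; ring. Qed.

Let bump_increasing v : sign_increasing (bump v).
Proof.
move=> w x; rewrite flip_diff_bump.
by have /andP[] := flip_diff_clip_sum_itv (weight_ge0 v) w x.
Qed.

Let mean_bump v : mean (bump v) = 1.
Proof. by rewrite /bump meanD mean_smoothed_sign mean_cst ?card_cube_gt0 ?addr0. Qed.

Let mean_bump2_ge u v : adjacent u v -> 1 + b / 16 <= mean (fun x => bump u x * bump v x).
Proof.
move=> uv; have := harris_coordinate u (bump_increasing u) (bump_increasing v).
rewrite !mean_bump !(eq_mean (flip_diff_bump _ _)); apply: le_trans.
have := mean_flip_diff_smoothed_sign_ge u u; have := mean_flip_diff_smoothed_sign_ge v u.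
rewrite [weight v u]weightC /weight eqxx uv; have /andP[/negPf vu _] := uv.
rewrite eq_sym vu; move: b_itv => /andP[b_ge0 _]; nra.
Qed.

Lemma mean_prod_edge_ge e : (0 < m)%N -> e \in E ->
  1 + b / 16 <= mean (fun x => \prod_(v in e) (1 + smoothed_sign v x)).
Proof.
move=> m_gt0 eE; have card_e : size (enum e) = m.+1 by rewrite -cardE E_uniform.
have in_e v : v \in enum e -> v \in e by rewrite mem_enum.
under eq_mean do rewrite -big_enum.
case: (enum e) card_e in_e (enum_uniq (mem e)) => [|u [|v s]] //=; first by case: m m_gt0.
move=> _ in_e /andP[]; rewrite inE => /norP[uv _] _.
have auv : adjacent u v.
  by rewrite /adjacent uv; apply/existsP; exists e; rewrite eE !in_e ?inE ?eqxx ?orbT.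
have rest_ge1 : 1 <= mean (fun x => \prod_(w <- s) bump w x).
  apply: le_trans (harris_prod _ bump_ge0 bump_increasing).
  by rewrite big1 // => w _; apply: mean_bump.
apply: le_trans (mean_bump2_ge auv) _.
apply: le_trans (_ : mean (fun x => bump u x * bump v x) *
  mean (fun x => \prod_(w <- s) bump w x) <= _).
  by apply: ler_peMr => //; apply: mean_ge0 => x; rewrite mulr_ge0.
apply: le_trans (harris _ _) _.
- by apply: sign_increasingM.
- exact: sign_increasing_prod.
- by apply: ler_mean => x; rewrite !big_cons mulrA.
Qed.

Lemma mean_sqr_sum_smoothed_sign_le :
  mean (fun x => (\sum_v smoothed_sign v x) ^+ 2) <= #|V|%:R * (4^-1 + (m * d)%:R * b) ^+ 2.
Proof.
apply: le_trans (efron_stein _) _.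
rewrite mean_sum big1 => [|v _]; last exact: mean_smoothed_sign.
rewrite expr0n add0r mulr_natl -sumr_const; apply: ler_sum => w _.
rewrite -[leRHS](mean_cst (card_cube_gt0 V)); apply: ler_mean => x.
have diff_itv v := flip_diff_clip_sum_itv (weight_ge0 v) w x.
rewrite flip_diff_sum lerXn2r ?nnegrE //.
- by apply: sumr_ge0 => v _; have /andP[] := diff_itv v.
- by move: b_itv => /andP[b_ge0 _]; rewrite addr_ge0 // mulr_ge0.
apply: le_trans (_ : \sum_v weight w v <= _).
  by apply: ler_sum => v _; rewrite weightC; have /andP[] := diff_itv v.
by apply: (@sum_weight_le id); [| case/andP: b_itv].
Qed.

Lemma mean_sigmaH_smoothed_sign_ge (n : R := #|V|%:R) : (0 < m)%N -> (0 < #|V|)%N ->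
  n * d%:R * b / 16 - 2 ^+ m.+1 * d%:R * (4^-1 + (m * d)%:R * b) ^+ 2 <=
  mean (fun x => sigmaH E (fun (_ : 'I_m.+1) v => 1 + smoothed_sign v x)).
Proof.
move=> m_gt0 V_gt0; have n_gt0 : 0 < n by rewrite ltr0n.
pose avg x := n^-1 * \sum_v smoothed_sign v x.
have mean_avg : mean avg = 0.
  by rewrite meanZ mean_sum big1 ?mulr0 // => v _; apply: mean_smoothed_sign.
have mean_sqr_avg : n * mean (fun x => avg x ^+ 2) <= (4^-1 + (m * d)%:R * b) ^+ 2.
  under eq_mean do rewrite exprMn; rewrite meanZ mulrA expr2 mulVKf ?gt_eqF //.
  by rewrite mulrC ler_pdivrMr // mulrC mean_sqr_sum_smoothed_sign_le.
have edges_ge : n * d%:R * (1 + b / 16) <=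
    m.+1%:R * \sum_(e in E) mean (fun x => \prod_(v in e) (1 + smoothed_sign v x)).
  rewrite -natrM -(handshake E_uniform E_regular) natrM -mulrA ler_wpM2l // mulr_natl -sumr_const.
  by apply: ler_sum => e; apply: mean_prod_edge_ge.
have sign_le1 x v : `|smoothed_sign v x| <= 1 by rewrite ler_norml smoothed_sign_itv.
apply: le_trans (ler_mean (fun x => sigmaH_diag1D_ge E_uniform E_regular V_gt0 (sign_le1 x))).
rewrite meanB 2!meanZ 2!meanD (meanZ _ avg) mean_avg (meanZ _ (fun x => avg x ^+ 2)) mean_sum.
rewrite mean_cst ?card_cube_gt0 // -/n.
have := ler_wpM2l (mulr_ge0 (exprn_ge0 m.+1 (ler0n R 2)) (ler0n R d)) mean_sqr_avg.
lra.
Qed.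

End SmoothedSigns.

Section BalancedVectors.
Variables (K : numFieldType) (V : finType) (e : {set V}).

Lemma sigmaH_balanced m (E : {set {set V}}) (x : V -> K) : uniform m.+1 E -> e \in E ->
  (forall v, v \notin e -> x v = 0) -> \sum_v x v = 0 ->
  sigmaH E (fun _ : 'I_m.+1 => x) = m.+1%:R * \prod_(v in e) x v.
Proof.
move=> E_uniform eE x_supp x_sum.
rewrite (sigmaH_diag E_uniform) ?pnatr_eq0 -?lt0n ?fact_gt0 // x_sum expr0n mulr0 subr0.
rewrite (bigD1 e) //= [X in _ + X]big1 ?addr0 // => f /andP[fE fe].
have /subsetPn[v vf ve] : ~~ (f \subset e).
  by apply: contra fe => f_sub; rewrite eqEcard f_sub (E_uniform e eE) (E_uniform f fE) leqnn.
by rewrite (bigD1 v) //= x_supp // mul0r.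
Qed.

Lemma exists_balanced_vector k : #|e| = k.+3 ->
  exists2 x : V -> K, (forall v, `|x v| <= 1) &
    [/\ forall v, v \notin e -> x v = 0, \sum_v x v = 0 &
        \prod_(v in e) x v = 4^-1 * k.+1%:R ^- k.+1].
Proof.
move=> card_e; have [a ae] : exists a, a \in e by apply/card_gt0P; rewrite card_e.
have card_ea : #|e :\ a| = k.+2 by have := cardsD1 a e; rewrite ae card_e => -[].
have [b be] : exists b, b \in e :\ a by apply/card_gt0P; rewrite card_ea.
have card_eab : #|e :\ a :\ b| = k.+1 by have := cardsD1 b (e :\ a); rewrite be card_ea => -[].
pose x v : K := if v \in e :\ a :\ b then k.+1%:R^-1 else if v \in e then - 2^-1 else 0.
have x_rest v : v \in e :\ a :\ b -> x v = k.+1%:R^-1 by rewrite /x => ->.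
have [xa xb] : x a = - 2^-1 /\ x b = - 2^-1.
  by move: be; rewrite /x !inE !eqxx ae andbF => /andP[_ ->].
exists x => [v|].
  rewrite /x; case: ifP => _; first by rewrite normfV normr_nat invf_le1 ?ltr0n // ler1n.
  case: ifP => _; last by rewrite normr0.
  by rewrite normrN normfV normr_nat invf_le1 // ler1n.
have k_neq0 : k.+1%:R != 0 :> K by rewrite pnatr_eq0.
split=> [v ve||].
- by rewrite /x !inE (negPf ve) !andbF.
- rewrite (bigID (mem e)) /= [X in _ + X]big1 ?addr0 => [|v ve]; last first.
    by rewrite /x !inE (negPf ve) !andbF.
  rewrite (big_setD1 a) //= (big_setD1 b) //= xa xb (eq_bigr _ x_rest) sumr_const card_eab.
  by rewrite -[_ *+ _]mulr_natl; field.
- rewrite (big_setD1 a) //= (big_setD1 b) //= xa xb (eq_bigr _ x_rest) prodr_const card_eab exprVn.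
  by rewrite mulrA; congr (_ * _); field.
Qed.

End BalancedVectors.

Lemma exists_sigmaH_diag_ge_small (R : realFieldType) (V : finType) k (E : {set {set V}}) e :
  uniform k.+3 E -> e \in E ->
  exists2 x : V -> R, (forall v, `|x v| <= 1) &
    4^-1 * k.+1%:R ^- k.+1 <= sigmaH E (fun _ : 'I_k.+3 => x).
Proof.
move=> E_uniform eE.
have [x x_le1 [x_supp x_sum x_prod]] := exists_balanced_vector R (E_uniform e eE).
exists x => //; rewrite (sigmaH_balanced E_uniform eE x_supp x_sum) x_prod.
by rewrite ler_peMl ?ler1n // mulr_ge0 // invr_ge0 exprn_ge0.
Qed.

Definition smoothing_ratio (R : realFieldType) m : R := (128 * 2 ^+ m.+1 * m%:R ^+ 2)^-1.

Lemma smoothing_ratioK (R : realFieldType) m : (0 < m)%N ->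
  128 * 2 ^+ m.+1 * m%:R ^+ 2 * smoothing_ratio R m = 1.
Proof.
by move=> m_gt0; rewrite divff // !mulf_neq0 ?expf_neq0 ?pnatr_eq0 -?lt0n.
Qed.

Lemma smoothing_ratio_itv (R : realFieldType) m : (0 < m)%N ->
  0 < smoothing_ratio R m /\ m%:R * smoothing_ratio R m <= 128^-1.
Proof.
move=> m_gt0; have := smoothing_ratioK R m_gt0.
set eta := smoothing_ratio R m; set P : R := 2 ^+ m.+1; set k : R := m%:R => etaE.
have P_ge1 : 1 <= P by apply: exprn_ege1; lra.
have k_ge1 : 1 <= k by rewrite ler1n.
have eta_gt0 : 0 < eta by rewrite -(pmulr_rgt0 _ (_ : 0 < 128 * P * k ^+ 2)) ?etaE //; nra.
split=> //; have : k * eta <= P * k ^+ 2 * eta by rewrite ler_wpM2r ?(ltW eta_gt0) //; nra.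
lra.
Qed.

(* The two squares come from the own signs and from the neighbours' signs respectively;
   the definition of [smoothing_ratio] makes the second one small as soon as [s ^+ 3 <= n]. *)
Lemma smoothing_gain_ge (R : realFieldType) m (n s : R) (eta : R := smoothing_ratio R m) :
  (0 < m)%N -> 0 <= s -> 8 * 2 ^+ m.+1 * s <= n * eta -> s ^+ 3 <= n ->
  eta / 32 * (n * s) <= n * s * eta / 16 - 2 ^+ m.+1 * s ^+ 2 * (4^-1 + m%:R * eta * s) ^+ 2.
Proof.
move=> m_gt0 s_ge0; set P : R := 2 ^+ m.+1; set k : R := m%:R => n_large s_cube_le.
have [eta_gt0 _] := smoothing_ratio_itv R m_gt0; have := smoothing_ratioK R m_gt0.
rewrite -/P -/k -/eta in eta_gt0 * => etaE.
have P_ge0 : 0 <= P by apply: exprn_ge0.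
have own_signs_le : P * s * s <= n * eta / 8 * s by rewrite ler_wpM2r //; lra.
have neighbours_le : P * s ^+ 2 * (k * eta * s) ^+ 2 <= n * s * eta / 128.
  rewrite (_ : _ * _ = (128 * P * k ^+ 2 * eta) * (s * eta / 128 * s ^+ 3)); last by field.
  rewrite etaE mul1r (_ : n * s * eta / 128 = s * eta / 128 * n); last by ring.
  by apply: ler_wpM2l => //; rewrite divr_ge0 // mulr_ge0 // ltW.
have square_le : (4^-1 + k * eta * s) ^+ 2 <= 8^-1 + 2 * (k * eta * s) ^+ 2.
  by have := sqr_ge0 (4^-1 - k * eta * s); lra.
have := ler_wpM2l (mulr_ge0 P_ge0 (sqr_ge0 s)) square_le.
lra.
Qed.

Lemma exists_sigmaH_diag_ge_large (R : rcfType) (V : finType) m (E : {set {set V}}) d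
    (n : R := #|V|%:R) (s : R := Num.sqrt d%:R) (eta : R := smoothing_ratio R m) :
  uniform m.+1 E -> regular d E -> (0 < m)%N -> (0 < #|V|)%N -> (0 < d)%N ->
  8 * 2 ^+ m.+1 * s <= n * eta -> s ^+ 3 <= n ->
  exists2 x : V -> R, (forall v, `|x v| <= 2) &
    eta / 32 * (n * s) <= sigmaH E (fun _ : 'I_m.+1 => x).
Proof.
move=> E_uniform E_regular m_gt0 V_gt0 d_gt0 n_large s_cube_le.
have [eta_gt0 m_eta] := smoothing_ratio_itv R m_gt0; rewrite -/eta in eta_gt0 m_eta.
have m_ge1 : 1 <= m%:R :> R by rewrite ler1n.
have s_ge1 : 1 <= s by rewrite -sqrtr1 ler_wsqrtr // ler1n.
have s_gt0 : 0 < s by lra.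
have s_sqr : s ^+ 2 = d%:R by rewrite sqr_sqrtr.
have eta_le : eta <= 128^-1 by nra.
have b_itv : 0 <= eta / s <= 2^-1.
  by rewrite (divr_ge0 (ltW eta_gt0) (ltW s_gt0)) ler_pdivrMr //=; lra.
have b_sum : (m * d)%:R * (eta / s) = m%:R * eta * s by rewrite natrM -s_sqr; field; lra.
have b_sqr : (m * d)%:R * (eta / s) ^+ 2 <= 16^-1.
  by rewrite expr2 mulrA b_sum (_ : _ * (eta / s) = m%:R * eta * eta); [nra | field; lra].
have [t mean_le] := exists_ge_mean (card_cube_gt0 V)
  (fun t => sigmaH E (fun (_ : 'I_m.+1) v => 1 + smoothed_sign E (eta / s) v t)).
exists (fun v => 1 + smoothed_sign E (eta / s) v t) => [v|].
  by have := smoothed_sign_itv E (eta / s) v t; rewrite ler_norml; lra.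
apply: le_trans mean_le.
apply: le_trans (mean_sigmaH_smoothed_sign_ge E_uniform E_regular b_itv b_sqr m_gt0 V_gt0).
rewrite b_sum -s_sqr -/n (_ : n * s ^+ 2 * (eta / s) = n * s * eta); last by field; lra.
by apply: smoothing_gain_ge => //; apply: ltW.
Qed.

Lemma exists_sigmaH_diag_ge (R : rcfType) k :
  exists2 c : R, 0 < c & forall (V : finType) (E : {set {set V}}) (d : nat),
    uniform k.+3 E -> regular d E -> (0 < #|V|)%N -> (0 < d)%N ->
    Num.sqrt d%:R ^+ 3 <= #|V|%:R :> R ->
    exists2 x : V -> R, (forall v, `|x v| <= 2) &
      c * (#|V|%:R * Num.sqrt d%:R) <= sigmaH E (fun _ : 'I_k.+3 => x).
Proof.
pose eta : R := smoothing_ratio R k.+2; pose K : R := 8 * 2 ^+ k.+3 / eta.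
pose c_small : R := 4^-1 * k.+1%:R ^- k.+1.
have [eta_gt0 _] := smoothing_ratio_itv R (isT : (0 < k.+2)%N); rewrite -/eta in eta_gt0.
have K_gt0 : 0 < K by rewrite divr_gt0 // mulr_gt0 // exprn_gt0.
have c_small_gt0 : 0 < c_small by rewrite mulr_gt0 // invr_gt0 exprn_gt0.
exists (Num.min (eta / 32) (c_small / K ^+ 2)).
  by rewrite lt_min !divr_gt0 // exprn_gt0.
move=> V E d E_uniform E_regular V_gt0 d_gt0.
set n : R := #|V|%:R; set s : R := Num.sqrt d%:R => s_cube_le.
have s_gt0 : 0 < s by rewrite sqrtr_gt0 ltr0n.
have n_gt0 : 0 < n by rewrite ltr0n.
have ns_ge0 : 0 <= n * s by rewrite mulr_ge0 // ltW.
have [n_large|n_small] := lerP (8 * 2 ^+ k.+3 * s) (n * eta).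
  have [x x_le2 x_ge] :=
    exists_sigmaH_diag_ge_large E_uniform E_regular isT V_gt0 d_gt0 n_large s_cube_le.
  exists x => //; apply: le_trans x_ge.
  by rewrite ler_wpM2r // ge_min lexx.
have [v _] := card_gt0P V_gt0.
have [e] : exists e, e \in [set e in E | v \in e] by apply/card_gt0P; rewrite E_regular.
rewrite inE => /andP[eE _]; have [x x_le1 x_ge] := exists_sigmaH_diag_ge_small R E_uniform eE.
exists x => [u|]; first by apply: le_trans (x_le1 u) _; lra.
apply: le_trans x_ge; apply: le_trans (_ : c_small / K ^+ 2 * (n * s) <= _).
  by rewrite ler_wpM2r // ge_min lexx orbT.
rewrite mulrAC ler_pdivrMr ?exprn_gt0 // ler_wpM2l ?(ltW c_small_gt0) //.
have n_lt : n < K * s by rewrite /K mulrAC ltr_pdivlMr.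
have s_sqr_lt : s ^+ 2 < K by rewrite -(ltr_pM2r s_gt0) -exprSr; apply: le_lt_trans n_lt.
nra.
Qed.

Local Notation normc := ComplexField.Normc.normc.

Section ComplexModulus.
Variable R : rcfType.

Lemma normc_ge0 (z : R[i]) : 0 <= normc z.
Proof. by case: z => a b; apply: sqrtr_ge0. Qed.

Lemma normc_real (x : R) : normc x%:C%C = `|x|.
Proof. by rewrite /= expr0n addr0 sqrtr_sqr. Qed.

Lemma normc_sum_le (I : Type) (s : seq I) (F : I -> R[i]) :
  normc (\sum_(i <- s) F i) <= \sum_(i <- s) normc (F i).
Proof.
elim/big_rec2: _ => [|i z w _ norm_le]; first by rewrite ComplexField.Normc.normc0.
by apply: le_trans (le_normcD _ _) _; rewrite lerD2l.
Qed.

Lemma normc_prod (I : Type) (s : seq I) (F : I -> R[i]) :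
  normc (\prod_(i <- s) F i) = \prod_(i <- s) normc (F i).
Proof. exact: (big_morph _ (@ComplexField.Normc.normcM R) (ComplexField.Normc.normc1 R)). Qed.

Lemma normc_multiform_le (V : finType) m (a : {ffun 'I_m -> V} -> R[i]) x :
  (forall i v, normc (x i v) <= 1) -> normc (multiform a x) <= \sum_g normc (a g).
Proof.
move=> x_le1; apply: le_trans (normc_sum_le _ _) _; apply: ler_sum => g _.
rewrite ComplexField.Normc.normcM normc_prod ler_piMr ?normc_ge0 //.
by apply: prodr_ile1 => i _; rewrite normc_ge0 x_le1.
Qed.

Lemma sigmaH_real (V : finType) m (E : {set {set V}}) (x : 'I_m.+1 -> V -> R) :
  sigmaH E (fun i v => (x i v)%:C%C) = (sigmaH E x)%:C%C.
Proof.
rewrite !sigmaHE rmorph_sum; apply: eq_bigr => f _; rewrite rmorphM rmorph_prod; congr (_ * _).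
by rewrite rmorphB !rmorphM !fmorphV !rmorph_nat.
Qed.

End ComplexModulus.

Section LpNorm.
Variables (R : realType) (V : finType) (p : R).
Hypothesis p_gt0 : 0 < p.
Implicit Types x : V -> R.

Let powRK (a : R) : 0 <= a -> (a `^ p) `^ p^-1 = a.
Proof. by move=> a_ge0; rewrite -powRrM mulfV ?gt_eqF // powRr1. Qed.

Lemma le1_of_lpnormR x v : lpnormR p x = 1 -> `|x v| <= 1.
Proof.
move=> x_norm1; have sum_ge0 : 0 <= \sum_w `|x w| `^ p by apply: sumr_ge0 => w _; exact: powR_ge0.
rewrite -x_norm1 /lpnormR -[leLHS]powRK //.
apply: ge0_ler_powR; rewrite ?nnegrE ?invr_ge0 ?powR_ge0 ?(ltW p_gt0) //.
by rewrite (bigD1 v) //= lerDl sumr_ge0 // => w _; exact: powR_ge0.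
Qed.

Lemma lpnormC_normc (x : V -> R[i]) : lpnormC p x = lpnormR p (fun v => normc (x v)).
Proof.
by rewrite /lpnormC /lpnormR; under [in RHS]eq_bigr do rewrite ger0_norm ?normc_ge0 //.
Qed.

Lemma lpnormC_real x : lpnormC p (fun v => (x v)%:C%C) = lpnormR p x.
Proof. by rewrite /lpnormC; under eq_bigr do rewrite normc_real. Qed.

Lemma lpnormRZ (c : R) x : 0 <= c -> lpnormR p (fun v => c * x v) = c * lpnormR p x.
Proof.
move=> c_ge0; rewrite /lpnormR; under eq_bigr do rewrite normrM (ger0_norm c_ge0) powRM //.
have sum_ge0 : 0 <= \sum_v `|x v| `^ p by apply: sumr_ge0 => v _; exact: powR_ge0.
by rewrite -mulr_sumr powRM ?powR_ge0 // powRK.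
Qed.

Lemma lpnormR_le (b : R) x : (forall v, `|x v| <= b) -> 0 <= b ->
  lpnormR p x <= b * #|V|%:R `^ p^-1.
Proof.
move=> x_le b_ge0; rewrite /lpnormR -[b in leRHS]powRK // -powRM ?powR_ge0 //.
apply: ge0_ler_powR; rewrite ?nnegrE ?invr_ge0 ?(ltW p_gt0) //.
- by apply: sumr_ge0 => v _; exact: powR_ge0.
- by rewrite mulr_ge0 ?powR_ge0.
rewrite mulr_natr -sumr_const; apply: ler_sum => v _.
by apply: ge0_ler_powR; rewrite ?nnegrE ?(ltW p_gt0).
Qed.

Lemma lpnormR_gt0 x v : x v != 0 -> 0 < lpnormR p x.
Proof.
move=> xv; apply: powR_gt0; rewrite (bigD1 v) //=; apply: ltr_pwDl.
  by rewrite powR_gt0 // normr_gt0.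
by apply: sumr_ge0 => w _; exact: powR_ge0.
Qed.

End LpNorm.

Lemma sup_ge0 (R : realType) (A : set R) : (forall x, A x -> 0 <= x) -> 0 <= sup A.
Proof.
move=> A_ge0; have [A_sup|A_sup] := pselect (has_sup A); last by rewrite sup_out.
by have [[x Ax] _] := A_sup; apply: le_trans (A_ge0 _ Ax) (sup_upper_bound A_sup Ax).
Qed.

Lemma mu_ge0 (R : realType) (V : finType) r (E : {set {set V}}) (p : R) : 0 <= mu r E p.
Proof. by apply: sup_ge0 => _ [x _ <-]; apply: normc_ge0. Qed.

Section SupremumBounds.
Variables (R : realType) (V : finType) (m : nat) (E : {set {set V}}) (p : R).
Hypothesis p_gt0 : 0 < p.

Lemma normc_sigmaH_le_mu (x : 'I_m.+1 -> V -> R[i]) : (forall i, lpnormC p (x i) = 1) ->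
  normc (sigmaH E x) <= mu m.+1 E p.
Proof.
move=> x_norm1; apply: ub_le_sup; last by exists x.
exists (\sum_(f : {ffun 'I_m.+1 -> V}) normc (sigma_coef R[i] E f)) => _ [y y_norm1 <-].
rewrite sigmaHE; apply: normc_multiform_le => i v.
have := y_norm1 i; rewrite lpnormC_normc => /(le1_of_lpnormR p_gt0 v).
by rewrite ger0_norm ?normc_ge0.
Qed.

Lemma normr_sigmaH_le_mu (x : 'I_m.+1 -> V -> R) : (forall i, lpnormR p (x i) = 1) ->
  `|sigmaH E x| <= mu m.+1 E p.
Proof.
move=> x_norm1; rewrite -normc_real -sigmaH_real; apply: normc_sigmaH_le_mu => i.
by rewrite lpnormC_real.
Qed.

Lemma sigmaH_le_lambda2 (x : V -> R) : lpnormR p x = 1 ->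
  sigmaH E (fun _ : 'I_m.+1 => x) <= lambda2 m.+1 E p.
Proof.
move=> x_norm1; apply: ub_le_sup; last by exists x.
exists (mu m.+1 E p) => _ [y y_norm1 <-]; apply: le_trans (ler_norm _) _.
exact: normr_sigmaH_le_mu.
Qed.

Let normalize (x : V -> R) (v : V) : R := (lpnormR p x)^-1 * x v.

Let lpnormR_normalize x v : x v != 0 -> lpnormR p (normalize x) = 1.
Proof.
move=> xv; have x_gt0 := lpnormR_gt0 p xv.
by rewrite lpnormRZ ?invr_ge0 ?(ltW x_gt0) // mulVf ?gt_eqF.
Qed.

Let sigmaH_neq0 (x : 'I_m.+1 -> V -> R) : sigmaH E x != 0 -> forall i, exists v, x i v != 0.
Proof.
move=> sigma_neq0 i; apply/existsP; apply: contraNT sigma_neq0 => /existsPn x0.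
by rewrite sigmaHE (multiform_eq0 _ (i := i)) // => v; apply/eqP; have := x0 v; rewrite negbK.
Qed.

Let sigmaH_normalize (x : 'I_m.+1 -> V -> R) :
  sigmaH E (fun i => normalize (x i)) = sigmaH E x / \prod_i lpnormR p (x i).
Proof. by rewrite !sigmaHE multiformZ prodfV mulrC. Qed.

Let normr_sigmaH_normalize_ge (b B : R) (x : 'I_m.+1 -> V -> R) :
  (forall i v, `|x i v| <= b) -> 0 < B -> B <= `|sigmaH E x| ->
  B / b ^+ m.+1 * #|V|%:R `^ (- (m.+1%:R / p)) <= `|sigmaH E x| / \prod_i lpnormR p (x i).
Proof.
move=> x_le B_gt0 B_le; have sigma_neq0 : sigmaH E x != 0.
  by rewrite -normr_gt0 (lt_le_trans B_gt0).
have x_gt0 i : 0 < lpnormR p (x i) by have [v /lpnormR_gt0] := sigmaH_neq0 sigma_neq0 i; exact.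
have b_ge0 : 0 <= b by have [v _] := sigmaH_neq0 sigma_neq0 ord0; apply: le_trans (x_le ord0 v).
have prod_gt0 : 0 < \prod_i lpnormR p (x i) by apply: prodr_gt0.
have prod_le : \prod_i lpnormR p (x i) <= b ^+ m.+1 * #|V|%:R `^ (m.+1%:R / p).
  rewrite mulrC [m.+1%:R / p]mulrC powRrM powR_mulrn ?powR_ge0 // -exprMn mulrC.
  rewrite -[X in _ ^+ X]card_ord -prodr_const; apply: ler_prod => i _.
  by rewrite ltW //= lpnormR_le.
rewrite powRN -mulrA -invfM; apply: ler_pM => //; first exact: ltW.
  by rewrite invr_ge0 mulr_ge0 ?exprn_ge0 ?powR_ge0.
by rewrite lef_pV2 ?posrE // (lt_le_trans prod_gt0).
Qed.

Lemma lambda2_ge (b B : R) (x : V -> R) :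
  (forall v, `|x v| <= b) -> 0 < B -> B <= sigmaH E (fun _ : 'I_m.+1 => x) ->
  B / b ^+ m.+1 * #|V|%:R `^ (- (m.+1%:R / p)) <= lambda2 m.+1 E p.
Proof.
move=> x_le B_gt0 B_le; have sigma_gt0 := lt_le_trans B_gt0 B_le.
have [v xv] := sigmaH_neq0 (lt0r_neq0 sigma_gt0) ord0.
apply: le_trans (sigmaH_le_lambda2 (lpnormR_normalize xv)); rewrite sigmaH_normalize.
rewrite -[X in _ <= X / _](gtr0_norm sigma_gt0).
by apply: normr_sigmaH_normalize_ge; rewrite ?gtr0_norm.
Qed.

Lemma mu_ge (b B : R) (x : 'I_m.+1 -> V -> R) :
  (forall i v, `|x i v| <= b) -> 0 < B -> B <= `|sigmaH E x| ->
  B / b ^+ m.+1 * #|V|%:R `^ (- (m.+1%:R / p)) <= mu m.+1 E p.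
Proof.
move=> x_le B_gt0 B_le; apply: le_trans (normr_sigmaH_normalize_ge x_le B_gt0 B_le) _.
have sigma_neq0 : sigmaH E x != 0 by rewrite -normr_gt0 (lt_le_trans B_gt0).
have prod_ge0 : 0 <= \prod_i lpnormR p (x i) by apply: prodr_ge0 => i _; apply: powR_ge0.
rewrite -[X in _ / X](ger0_norm prod_ge0) -normf_div -sigmaH_normalize.
apply: normr_sigmaH_le_mu => i; have [v] := sigmaH_neq0 sigma_neq0 i.
exact: lpnormR_normalize.
Qed.

End SupremumBounds.

Lemma regular0_eq_set0 (V : finType) r (E : {set {set V}}) :
  uniform r.+1 E -> regular 0 E -> E = set0.
Proof.
move=> E_uniform E_regular; apply/eqP/set0Pn => -[e eE].
have [v ve] : exists v, v \in e by apply/card_gt0P; rewrite E_uniform.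
by have /eqP := E_regular v; rewrite cards_eq0 => /eqP/setP/(_ e); rewrite !inE eE ve.
Qed.

Lemma lambda2_set0_ge0 (R : realType) (V : finType) r (p : R) :
  0 <= lambda2 r (set0 : {set {set V}}) p.
Proof.
apply: sup_ge0 => _ [x _ <-]; rewrite /sigmaH /tauH big_pred0 => [|f]; last by rewrite inE.
by rewrite cards0 muln0 mulr0 !mul0r subr0.
Qed.

Lemma powR1B (R : realType) (n a : R) : 0 < n -> n `^ (1 - a) = n * n `^ (- a).
Proof. by move=> n_gt0; rewrite powRD ?powRr1 ?(ltW n_gt0) // (gt_eqF n_gt0) implybT. Qed.

Lemma sqrtr_cube_le (R : realType) (a n : R) : 0 <= a -> 0 <= n ->
  a <= n `^ (2 / 3) -> Num.sqrt a ^+ 3 <= n.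
Proof.
move=> a_ge0 n_ge0 a_le.
rewrite -[leRHS](powRr1 n_ge0) -(@mulVf _ 3) // powRrM powR_mulrn ?powR_ge0 //.
rewrite lerXn2r ?nnegrE ?sqrtr_ge0 ?powR_ge0 //.
rewrite -[leRHS]ger0_norm ?powR_ge0 // -sqrtr_sqr ler_wsqrtr //.
by rewrite -powR_mulrn ?powR_ge0 // -powRrM (mulrC 3^-1).
Qed.

Lemma lambda2_ge_sqrt (R : realType) k :
  exists2 c : R, 0 < c & forall (V : finType) (E : {set {set V}}) (d : nat) (p : R),
    uniform k.+3 E -> regular d E -> 0 < p -> d%:R <= #|V|%:R `^ (2 / 3) :> R ->
    c * #|V|%:R `^ (1 - k.+3%:R / p) * Num.sqrt d%:R <= lambda2 k.+3 E p.
Proof.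
have [c c_gt0 sigma_ge] := exists_sigmaH_diag_ge R k.
exists (c / 2 ^+ k.+3); first by rewrite divr_gt0 ?exprn_gt0.
move=> V E d p E_uniform E_regular p_gt0 d_le.
have [d0|d_gt0] := posnP d.
  rewrite d0 in E_regular *; rewrite (regular0_eq_set0 E_uniform E_regular) sqrtr0 mulr0.
  exact: lambda2_set0_ge0.
have V_gt0 : (0 < #|V|)%N.
  rewrite lt0n; apply: contraL d_le => /eqP ->.
  by rewrite powR0 ?mulf_neq0 // -ltNge ltr0n.
have n_gt0 : 0 < #|V|%:R :> R by rewrite ltr0n.
have [x x_le x_ge] := sigma_ge V E d E_uniform E_regular V_gt0 d_gt0
  (sqrtr_cube_le (ler0n _ _) (ler0n _ _) d_le).
have B_gt0 : 0 < c * (#|V|%:R * Num.sqrt d%:R) by rewrite !mulr_gt0 ?sqrtr_gt0 ?ltr0n.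
apply: le_trans (lambda2_ge p_gt0 x_le B_gt0 x_ge).
by rewrite powR1B // le_eqVlt; apply/predU1P; left; ring.
Qed.

Lemma mu_ge_sqrt (R : realType) m : (1 < m)%N ->
  exists2 c : R, 0 < c & forall (V : finType) (E : {set {set V}}) (d : nat) (p : R),
    uniform m.+1 E -> regular d E -> 0 < p -> d%:R < #|V|%:R ^+ 2 / 4 :> R ->
    c * #|V|%:R `^ (1 - m.+1%:R / p) * Num.sqrt d%:R <= mu m.+1 E p.
Proof.
move=> m_gt1; pose c : R := ((m`!)%:R * 2 ^+ m)^-1.
have c_gt0 : 0 < c by rewrite invr_gt0 mulr_gt0 ?exprn_gt0 // ltr0n fact_gt0.
exists c => // V E d p E_uniform E_regular p_gt0 d_lt.
have [->|d_gt0] := posnP d; first by rewrite sqrtr0 mulr0 mu_ge0.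
have V_gt0 : (0 < #|V|)%N.
  rewrite lt0n; apply: contraL d_lt => /eqP ->.
  by rewrite expr0n mul0r -leNgt.
have n_gt0 : 0 < #|V|%:R :> R by rewrite ltr0n.
have [x x_le x_ge] := exists_sigmaH_ge_sqrt E_uniform E_regular V_gt0 m_gt1 d_gt0 d_lt.
have B_gt0 : 0 < c * (#|V|%:R * Num.sqrt d%:R) by rewrite !mulr_gt0 ?sqrtr_gt0 ?ltr0n.
apply: le_trans (mu_ge p_gt0 x_le B_gt0 x_ge); rewrite expr1n divr1 powR1B //.
by rewrite le_eqVlt; apply/predU1P; left; ring.
Qed.

Lemma mu_ge_degree (R : realType) (V : finType) m (E : {set {set V}}) d (p : R) :
  uniform m.+2 E -> regular d E -> 0 < p -> (0 < #|V|)%N ->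
  d%:R * #|V|%:R `^ (- (m.+2%:R / p)) <= mu m.+2 E p.
Proof.
move=> E_uniform E_regular p_gt0 V_gt0.
have [->|d_gt0] := posnP d; first by rewrite mul0r mu_ge0.
have [x x_le x_ge] := exists_sigmaH_ge_degree R E_uniform E_regular V_gt0.
have := mu_ge p_gt0 x_le (_ : 0 < d%:R) x_ge.
by rewrite expr1n divr1 ltr0n; apply.
Qed.

Theorem theorem1p8 (R : realType) (r : nat) :
  (3 <= r)%N ->
  exists c : R, 0 < c /\
  forall (V : finType) (E : {set {set V}}) (d : nat),
    uniform r E -> regular d E ->
    [/\ ((d%:R : R) <= (#|V|%:R : R) `^ (2 / 3 : R) ->
           forall p : R, 1 <= p ->
             c * (#|V|%:R : R) `^ (1 - r%:R / p) * Num.sqrt (d%:R : R) <= lambda2 r E p),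
        ((d%:R : R) < (#|V|%:R : R) ^+ 2 / 4 ->
           forall p : R, 1 <= p ->
             c * (#|V|%:R : R) `^ (1 - r%:R / p) * Num.sqrt (d%:R : R) <= mu r E p) &
        ((4 <= r)%N ->
         (#|V|%:R : R) ^+ 2 / 4 <= (d%:R : R) ->
         (d%:R : R) <= 2^-1 * ('C(#|V|.-1, r.-1))%:R ->
           forall p : R, 1 <= p ->
             c * (d%:R : R) * (#|V|%:R : R) `^ (- (r%:R / p)) <= mu r E p)].
Proof.
case: r => [|[|[|k]]] // _.
have [c_lambda2 c_lambda2_gt0 lambda2_bound] := lambda2_ge_sqrt R k.
have [c_mu c_mu_gt0 mu_bound] := mu_ge_sqrt R (isT : (1 < k.+2)%N).
pose c := Num.min (Num.min c_lambda2 c_mu) 1.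
have [c_le_lambda2 c_le_mu c_le1] : [/\ c <= c_lambda2, c <= c_mu & c <= 1].
  by rewrite !ge_min !lexx !orbT.
exists c; split=> [|V E d E_uniform E_regular].
  by rewrite !lt_min c_lambda2_gt0 c_mu_gt0 ltr01.
split=> [d_le p p_ge1|d_lt p p_ge1|_ _ d_le p p_ge1]; have p_gt0 := lt_le_trans ltr01 p_ge1.
- apply: le_trans (lambda2_bound V E d p E_uniform E_regular p_gt0 d_le).
  by rewrite !ler_wpM2r ?sqrtr_ge0 ?powR_ge0.
- apply: le_trans (mu_bound V E d p E_uniform E_regular p_gt0 d_lt).
  by rewrite !ler_wpM2r ?sqrtr_ge0 ?powR_ge0.
have [V0|V_gt0] := posnP #|V|.
  by move: d_le; rewrite V0 bin0n mulr0 lern0 => /eqP ->; rewrite mulr0 mul0r mu_ge0.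
apply: le_trans (mu_ge_degree E_uniform E_regular p_gt0 V_gt0).
by rewrite -mulrA ler_piMl // mulr_ge0 ?powR_ge0.
Qed.
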